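(* Let $a_1,a_2,a_3,a_4\in\mathbb{Q}$ with $0<a_i<1$. The mirror map $q(a_1,a_2,a_3,a_4|z)$ is $N$-integral if and only if the multiset $\{a_1,a_2,a_3,a_4\}$ equals $\{\alpha,\beta,1-\alpha,1-\beta\}$ for some $(\alpha,\beta)$ among the following 14 pairs: $(\frac12,\frac12)$, $(\frac13,\frac23)$, $(\frac14,\frac12)$, $(\frac14,\frac14)$, $(\frac25,\frac15)$, $(\frac38,\frac18)$, $(\frac3{10},\frac1{10})$, $(\frac12,\frac16)$, $(\frac12,\frac13)$, $(\frac13,\frac16)$, $(\frac16,\frac16)$, $(\frac13,\frac14)$, $(\frac14,\frac16)$, $(\frac5{12},\frac1{12})$.
   Context: For $a=(a_1,a_2,a_3,a_4)$ put $(x)_k=x(x+1)\cdots(x+k-1)$, $(x)_0=1$, and define the formal power series $$F(a|z)=\sum_{k=0}^\infty \frac{(a_1)_k\cdots(a_4)_k}{k!^4}z^k,\qquad G(a|z)=\sum_{k=1}^\infty \frac{(a_1)_k\cdots(a_4)_k}{k!^4}\Big[\sum_{j=1}^4\sum_{i=0}^{k-1}\Big(\frac1{a_j+i}-\frac1{1+i}\Big)\Big]z^k .$$ The mirror map is $q(a|z)=z\exp\big(G(a|z)/F(a|z)\big)\in\mathbb{Q}[[z]]$. It is called $N$-integral if there exists a natural number $N\ge1$ such that $q(a|Nz)$ has integer coefficients. *)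

(* Defs.v *)
From mathcomp Require Import all_boot all_order all_algebra.

Set Implicit Arguments.
Unset Strict Implicit.
Unset Printing Implicit Defensive.

Import Order.TTheory GRing.Theory Num.Theory.
Local Open Scope ring_scope.

(* A formal power series over the rationals is its sequence of coefficients. *)
Definition fps := nat -> rat.

Definition fps_one : fps := fun n => (n == 0)%:R.

Definition fps_var : fps := fun n => (n == 1)%:R.

Definition fps_mul (f g : fps) : fps :=
  fun n => \sum_(i < n.+1) f i * g (n - i)%N.

Definition fps_pow (f : fps) (k : nat) : fps := iter k (fps_mul f) fps_one.

(* g(f(z)), meaningful only when f 0 = 0: then f^k has no term of degree
   less than k, so the coefficient of z^n only involves the k <= n. *)
Definition fps_comp (g f : fps) : fps :=
  fun n => \sum_(k < n.+1) g k * fps_pow f k n.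

Definition fps_exp (f : fps) : fps := fps_comp (fun k => (k`!%:R)^-1) f.

(* Geometric series: with c = f 0 <> 0 and u = 1 - f / c,
   1 / f = c^-1 * (1 + u + u^2 + ...); see fps_mulV below. *)
Definition fps_inv (f : fps) : fps :=
  fun n => (f 0)^-1 *
    fps_comp (fun=> 1) (fun m => fps_one m - (f 0)^-1 * f m) n.

Definition fps_div (f g : fps) : fps := fps_mul f (fps_inv g).

(* f(c z) *)
Definition fps_rescale (c : rat) (f : fps) : fps := fun n => c ^+ n * f n.

Definition fps_integral (f : fps) : Prop := forall n, f n \is a Num.int.

Definition pochhammer (x : rat) (k : nat) : rat := \prod_(i < k) (x + i%:R).

Definition F (a : 4.-tuple rat) : fps :=
  fun k => (\prod_(j < 4) pochhammer (tnth a j) k) / k`!%:R ^+ 4.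

(* The sum over i is empty for k = 0, so G has no constant term. *)
Definition G (a : 4.-tuple rat) : fps :=
  fun k => (\prod_(j < 4) pochhammer (tnth a j) k) / k`!%:R ^+ 4 *
    \sum_(j < 4) \sum_(i < k) ((tnth a j + i%:R)^-1 - (1 + i%:R)^-1).

Definition mirror_map (a : 4.-tuple rat) : fps :=
  fps_mul fps_var (fps_exp (fps_div (G a) (F a))).

Definition N_integral (q : fps) : Prop :=
  exists2 N : nat, (1 <= N)%N & fps_integral (fps_rescale N%:R q).

Definition mirror_pairs : seq (rat * rat) :=
  [:: (1 / 2, 1 / 2); (1 / 3, 2 / 3); (1 / 4, 1 / 2); (1 / 4, 1 / 4);
      (2 / 5, 1 / 5); (3 / 8, 1 / 8); (3 / 10, 1 / 10); (1 / 2, 1 / 6);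
      (1 / 2, 1 / 3); (1 / 3, 1 / 6); (1 / 6, 1 / 6); (1 / 3, 1 / 4);
      (1 / 4, 1 / 6); (5 / 12, 1 / 12)].

Lemma fps_pow_lt (f : fps) (k n : nat) :
  f 0 = 0 -> (n < k)%N -> fps_pow f k n = 0.
Proof.
move=> f0; elim: k n => // k IHk n ltnk.
rewrite /fps_pow iterS -/(fps_pow f k) /fps_mul big1 // => -[[|i] lti] _ /=.
  by rewrite f0 mul0r.
rewrite IHk ?mulr0 //; apply: leq_trans (_ : n <= k)%N; last by rewrite -ltnS.
by rewrite ltn_subrL /=; apply: leq_trans (lti : (i < n)%N).
Qed.

Lemma fps_mulV (f : fps) : f 0 != 0 -> fps_mul f (fps_inv f) =1 fps_one.
Proof.
move=> f0 n; set u : fps := fun m => fps_one m - (f 0)^-1 * f m.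
have u0 : u 0 = 0 by rewrite /u /fps_one eqxx mulVf // subrr.
have fE m : f m * (f 0)^-1 = fps_one m - u m.
  by rewrite /u opprB addrC subrK mulrC.
have -> : fps_mul f (fps_inv f) n =
    \sum_(i < n.+1) \sum_(k < n.+1) (fps_one i - u i) * fps_pow u k (n - i)%N.
  apply: eq_bigr => i _; rewrite /fps_inv mulrA fE -mulr_sumr; congr (_ * _).
  have le_ni : ((n - i).+1 <= n.+1)%N by rewrite ltnS leq_subr.
  rewrite /fps_comp (big_ord_widen _ (fun k => 1 * fps_pow u k (n - i)%N) le_ni).
  rewrite big_mkcond; apply: eq_bigr => k _; rewrite mul1r.
  by case: ltnP => // ltk; rewrite fps_pow_lt.
rewrite exchange_big /=.
under eq_bigr => k _.
  under eq_bigr do rewrite mulrBl.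
  rewrite sumrB [X in X - _]big_ord_recl big1 ?addr0; last first.
    by move=> i _; rewrite /fps_one mul0r.
  rewrite /fps_one eqxx mul1r subn0 -[X in _ - X]/(fps_pow u k.+1 n).
  over.
have tele m : \sum_(k < m) (fps_pow u k n - fps_pow u k.+1 n) =
    fps_one n - fps_pow u m n.
  elim: m => [|m IHm]; first by rewrite big_ord0 subrr.
  by rewrite big_ord_recr /= IHm addrA subrK.
by rewrite tele fps_pow_lt // subr0.
Qed.

(* Main.v *)
Require Import Defs.
From HB Require Import structures.
From mathcomp Require Import all_boot all_order all_algebra.
From mathcomp Require Import boolp.
From mathcomp Require Import ring lra zify.

(** Put T_a = G(a|z) / F(a|z), so that the mirror map is z exp(T_a).  Two
    classical principles turn integrality into congruences.

    - Dieudonne-Dwork (fint_exp_of_stretch, stretch_of_fint_exp): exp(T) has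
      p-integral coefficients if and only if T(z^p) - p T(z) lies in
      p Z_(p)[[z]].
    - Dwork (dwork_congruence, in the degrees needed here): if a' is the tuple
      for which each p a'_j - a_j is an integer in [0, p), then
      p T_a(z) = T_a'(z^p) modulo p.  Its heart is the vanishing modulo p of a
      convolution sum of A(j) A(l) h(j) antisymmetrised in (j, l), where A(k)
      are the coefficients of F and h(k) the harmonic sums
      (dwork_sum_pideal); it is proved by cutting off the last base-p digits
      of j and l.

    Write the parameters as x/d with a common denominator d; passing from a' to
    a is then multiplication of the numerators by p modulo d.

    If a is one of the listed multisets, it is stable under every unit modulo
    120, so a' is a rearrangement of a for all primes p > 5, and exp(T_a) is
    p-integral by the two principles.  At p = 2, 3, 5 the denominators of the
    coefficients grow at most geometrically (hT_growth) and are absorbed by N.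

    Conversely, integrality at almost all p gives T_a = T_a' modulo p in each
    fixed degree, hence T_a = T_a' exactly as soon as the class of p modulo d
    contains infinitely many primes.  Only finitely many primes lie in the
    other classes, and every unit modulo d is represented by an integer all of
    whose prime factors are large (rough_lift), so T_a is the same series for
    all conjugates of a under the units modulo d (almost_integral_conjugate).
    Two invariants of T_a then determine a.
    - Modulo a large prime p and z^p, the series F and G of a sorted conjugate
      have degrees close to p x1/d and p x2/d, so comparing degrees in
      F_a G_b = F_b G_a bounds the gap x2 - x1 by y2 - y1 (degree_gap).  For
      a and 1 - a this gives a1 + a4 = a2 + a3.
    - The coefficient of z in T_a is e3 - 4 e4 in the elementary symmetric
      functions; comparing its values at a and 1 - a forces a1 + a4 = 1, and
      together with the gap a2 - a1 it determines a (orbit_symmetric,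
      orbit_constant).
    So the multiset a is stable under all units modulo d.  It contains every
    reduced fraction in (0, 1) having the same denominator n as one of its
    members, so phi(n) <= 4, n divides 120, and a finite search remains. *)

Set Implicit Arguments.
Unset Strict Implicit.
Unset Printing Implicit Defensive.

Import Order.TTheory GRing.Theory Num.Theory.
Local Open Scope ring_scope.

(** * Rationals integral at p *)

(** The localisation of the integers at p, for prime p. *)
Definition pint (p : nat) : {pred rat} := [pred x | coprime p `|denq x|].

Lemma pintP (p : nat) (x : rat) :
  reflect (exists2 m : nat, coprime p m & m%:R * x \is a Num.int)
          (x \in pint p).
Proof.
apply: (iffP idP) => [cpx | [m cpm /intrP[z zE]]].
  exists `|denq x|%N => //; have -> : (`|denq x|%N)%:R = (denq x)%:~R :> rat.
    by rewrite -[in RHS](absz_denq x) -pmulrn.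
  by rewrite mulrC -numqE rpred_int.
have : numq x * m%:Z = z * denq x.
  apply: (@intr_inj rat); rewrite !rmorphM /= numqE -zE -pmulrn; ring.
move/(congr1 absz); rewrite !abszM absz_nat => e.
have : (`|denq x| %| m)%N.
  rewrite -(@Gauss_dvdr _ `|numq x|) ?e ?dvdn_mull //.
  by rewrite coprime_sym coprime_num_den.
by move/coprime_dvdr; apply.
Qed.

Fact pint_subring p : subring_closed (pint p).
Proof.
split=> [|x y|x y].
- exact: coprimen1.
- case/pintP=> m pm mx /pintP[n pn ny]; apply/pintP; exists (m * n)%N.
    by rewrite coprimeMr pm.
  have -> : (m * n)%:R * (x - y) = n%:R * (m%:R * x) - m%:R * (n%:R * y).
    by rewrite natrM; ring.
  by apply: rpredB; apply: rpredM => //; apply: rpred_nat.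
- case/pintP=> m pm mx /pintP[n pn ny]; apply/pintP; exists (m * n)%N.
    by rewrite coprimeMr pm.
  by rewrite natrM mulrACA; apply: rpredM.
Qed.
HB.instance Definition _ p :=
  GRing.isSubringClosed.Build rat (pint p) (pint_subring p).

Lemma int_pint p (x : rat) : x \is a Num.int -> x \in pint p.
Proof. by move=> xi; apply/pintP; exists 1%N; rewrite ?coprimen1 ?mul1r. Qed.

Lemma pintV_nat p n : coprime p n -> (n%:R)^-1 \in pint p.
Proof.
move=> pn; apply/pintP; exists n => //.
have [->|n0] := eqVneq n 0%N; first by rewrite mul0r.
by rewrite mulfV ?pnatr_eq0.
Qed.

(** A denominator prime to every prime is 1. *)
Lemma int_of_pint (x : rat) :
  (forall p, prime p -> x \in pint p) -> x \is a Num.int.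
Proof.
move=> xp; rewrite Qint_def; apply/eqP.
suff e : `|denq x|%N = 1%N by rewrite -absz_denq e.
apply/eqP; apply: contraT => ne1.
have gt1 : (1 < `|denq x|)%N by rewrite ltn_neqAle eq_sym ne1 absz_gt0 denq_neq0.
have /xp := pdiv_prime gt1; rewrite inE prime_coprime ?pdiv_prime //.
by rewrite pdiv_dvd.
Qed.

(** The ideal p^k Z_(p). *)
Definition pideal (p k : nat) : {pred rat} :=
  [pred x | x / p%:R ^+ k \in pint p].

Lemma pidealE p k x : (x \in pideal p k) = (x / p%:R ^+ k \in pint p).
Proof. by []. Qed.

Fact pideal_zmod p k : zmod_closed (pideal p k).
Proof.
by split=> [|x y]; rewrite !pidealE ?mul0r ?rpred0 // mulrBl => xp yp; apply: rpredB.
Qed.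
HB.instance Definition _ p k :=
  GRing.isZmodClosed.Build rat (pideal p k) (pideal_zmod p k).

Lemma pideal0 p x : (x \in pideal p 0) = (x \in pint p).
Proof. by rewrite pidealE divr1. Qed.

Lemma pidealM p k l x y :
  x \in pideal p k -> y \in pideal p l -> x * y \in pideal p (k + l).
Proof.
move=> xk yl; rewrite pidealE exprD invfM mulrACA.
exact: rpredM xk yl.
Qed.

Lemma pidealMr p k x y : x \in pint p -> y \in pideal p k -> x * y \in pideal p k.
Proof. by move=> xp yk; rewrite -[k]add0n pidealM // pideal0. Qed.

Lemma pidealMl p k x y : x \in pideal p k -> y \in pint p -> x * y \in pideal p k.
Proof. by move=> xp yk; rewrite -[k]addn0 pidealM // pideal0. Qed.

Lemma pideal_exp p k : (0 < p)%N -> p%:R ^+ k \in pideal p k.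
Proof. by move=> p0; rewrite pidealE mulfV ?rpred1 // expf_neq0 // pnatr_eq0 -lt0n. Qed.

Lemma pidealXM p k x : (0 < p)%N -> x \in pint p -> p%:R ^+ k * x \in pideal p k.
Proof. by move=> p0 xp; apply: pidealMl => //; apply: pideal_exp. Qed.

Lemma pideal1M p x : (0 < p)%N -> x \in pint p -> p%:R * x \in pideal p 1.
Proof. by move=> p0; rewrite -[p%:R]expr1; exact: pidealXM. Qed.

Lemma pideal_le p k l x :
  (0 < p)%N -> (k <= l)%N -> x \in pideal p l -> x \in pideal p k.
Proof.
move=> p0 /subnK <- xl; rewrite pidealE.
have -> : x / p%:R ^+ k = x / p%:R ^+ (l - k + k) * p%:R ^+ (l - k).
  have pn0 : p%:R != 0 :> rat by rewrite pnatr_eq0 -lt0n.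
  by rewrite exprD; field; rewrite ?pn0 ?expf_neq0.
by apply: rpredM => //; rewrite -natrX rpred_nat.
Qed.

Lemma pideal_pint p k x : (0 < p)%N -> x \in pideal p k -> x \in pint p.
Proof. by move=> p0 /(pideal_le p0 (leq0n k)); rewrite pideal0. Qed.

Lemma dvdz_pideal p k (z : int) :
  (0 < p)%N -> ((p ^ k)%N %| z)%Z -> z%:~R \in pideal p k.
Proof.
move=> p0 /dvdzP[w ->]; rewrite rmorphM /= mulrC -pmulrn natrX.
by apply: pidealXM => //; apply: int_pint; apply: rpred_int.
Qed.

Lemma pideal_nat p k n :
  (0 < p)%N -> (n%:R \in pideal p k) = (p ^ k %| n)%N.
Proof.
move=> p0; apply/idP/idP => [|d]; last by rewrite pmulrn dvdz_pideal.
case/pintP=> m pm /intrP[z zE].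
have pk0 : p%:R ^+ k != 0 :> rat by rewrite expf_neq0 // pnatr_eq0 -lt0n.
have e : (m * n)%:Z = z * (p ^ k)%N%:Z.
  have e' : ((m * n)%:Z)%:~R = (z * (p ^ k)%N%:Z)%:~R :> rat.
    by rewrite intrM -[z%:~R]zE -!pmulrn natrM natrX; field.
  exact: intr_inj e'.
have : (p ^ k %| m * n)%N.
  by have := congr1 absz e; rewrite abszM !absz_nat => ->; rewrite dvdn_mull.
by rewrite Gauss_dvdr // coprimeXl.
Qed.

(** The denominator is invertible modulo p^k, so the numerator can be divided
    by it there. *)
Lemma pint_residue p k x :
  (0 < p)%N -> x \in pint p -> exists n : nat, x - n%:R \in pideal p k.
Proof.
move=> p0 xp; set m := `|denq x|%N.
have pkm : coprime m (p ^ k) by rewrite coprime_sym coprimeXl.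
have m0 : (0 < m)%N by rewrite absz_gt0 denq_neq0.
have [u v e _] := egcdnP (p ^ k) m0; rewrite (eqP pkm) in e.
have [n nE] : exists n : nat, ((p ^ k)%N %| n%:Z - numq x * u%:Z)%Z.
  exists `|(numq x * u%:Z %% (p ^ k)%N%:Z)%Z|%N.
  rewrite gez0_abs ?modz_ge0 -?lt0n ?eqz_nat -?lt0n ?expn_gt0 ?p0 //.
  by rewrite -eqz_mod_dvd modz_mod.
exists n.
have mE : m%:R = (denq x)%:~R :> rat by rewrite -[in RHS](absz_denq x) -pmulrn.
have mn0 : m%:R != 0 :> rat by rewrite pnatr_eq0 -lt0n.
have -> : x - n%:R = (m%:R)^-1 * (numq x * (1 - u%:Z * m%:Z)
                   - (n%:Z - numq x * u%:Z) * m%:Z)%:~R.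
  rewrite !(intrM, rmorphB) /= !intrM ?intrB ?intrM numqE -mE -!pmulrn. by field.
apply: pidealMr; first by apply: pintV_nat; rewrite -/m.
apply: dvdz_pideal => //; apply: rpredB; last by rewrite dvdz_mulr.
rewrite -PoszM e; apply: dvdz_mull.
by rewrite PoszD opprD addrC subrK rpredN PoszM dvdz_mull.
Qed.

(** Outside the maximal ideal everything is invertible: Z_(p) is local. *)
Lemma pint_unit p x : prime p -> x \in pint p -> x \notin pideal p 1 ->
  x != 0 /\ x^-1 \in pint p.
Proof.
move=> pp xp xn; have p0 := prime_gt0 pp.
have x0 : x != 0 by apply: contraNneq xn => ->; rewrite rpred0.
split=> //; have [n nx] := pint_residue 1 p0 xp.
have pn : coprime p n.
  rewrite prime_coprime // -[p]expn1 -pideal_nat //.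
  by apply: contra xn => np; rewrite -[x](subrK n%:R) rpredD.
apply/pintP; exists `|numq x|%N.
  rewrite prime_coprime //; apply: contra xn => pd.
  rewrite -[x]divq_num_den; apply: pidealMl.
    by apply: dvdz_pideal => //; rewrite expn1.
  rewrite -absz_denq -pmulrn; apply: pintV_nat; exact: xp.
rewrite natr_absz intr_norm -{2}[x]divq_num_den invf_div.
have nq0 : (numq x)%:~R != 0 :> rat by rewrite intr_eq0 numq_eq0.
case: (ger0P ((numq x)%:~R : rat)) => _; rewrite ?mulNr mulrC mulfVK //.
by rewrite rpredN; exact: intr_int.
Qed.

Lemma natr_eqmod_pideal p t m n : (0 < p)%N -> m = n %[mod p ^ t] ->
  m%:R - n%:R \in pideal p t.
Proof.
move=> p0; wlog le_nm : m n / (n <= m)%N => [hw e|e].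
  have [nm|mn] := leqP n m; first exact: hw.
  by rewrite -opprB rpredN; apply: hw => //; apply: ltnW.
by rewrite -natrB // pideal_nat // -eqn_mod_dvd //; apply/eqP.
Qed.

Lemma pideal_trans p k y x z :
  x - y \in pideal p k -> y - z \in pideal p k -> x - z \in pideal p k.
Proof.
move=> xy yz; have -> : x - z = (x - y) + (y - z) by rewrite addrA subrK.
exact: rpredD.
Qed.

Lemma pideal_of_diff p k y x : x - y \in pideal p k -> y \in pideal p k ->
  x \in pideal p k.
Proof. by move=> xy yp; rewrite -[x](subrK y) rpredD. Qed.

(** * Dwork's step on one parameter *)

(** The indices below v + u p in the residue class r modulo p are r + n p with
    n < u, and one more when r < v. *)
Lemma big_residue (T : Type) (idx : T) (op : Monoid.law idx) (F : nat -> T)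
    p r u v : (r < p)%N -> (v <= p)%N ->
  \big[op/idx]_(i < v + u * p | (i %% p == r)%N) F i =
  op (\big[op/idx]_(n < u) F (r + n * p)%N)
     (if (r < v)%N then F (r + u * p)%N else idx).
Proof.
move=> rp.
have base w (G : nat -> T) : (w <= p)%N -> \big[op/idx]_(i < w | (i %% p == r)%N) G i =
    (if (r < w)%N then G r else idx).
  move=> wp; case: ifP => rw.
    rewrite (big_pred1 (Ordinal rw)) // => i; rewrite /= modn_small //.
    exact: leq_trans (ltn_ord i) wp.
  rewrite big_pred0 // => i; rewrite modn_small ?(leq_trans (ltn_ord i)) //.
  by apply/eqP => ri; rewrite -ri ltn_ord in rw.
elim: u F => [|u IHu] F vp.
  by rewrite mul0n !addn0 base // big_ord0 Monoid.mul1m.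
rewrite mulSn addnCA big_split_ord /= base // rp.
under eq_bigl do rewrite modnDl.
rewrite (IHu (fun i => F (p + i)%N)) // big_ord_recl /= addn0 Monoid.mulmA.
rewrite addnCA; congr (op (op _ _) _).
by apply: eq_bigr => i _; rewrite /bump /= mulnDl mul1n addnCA.
Qed.

(** Dwork's map x |-> x', for which p x' - x is an integer r in [0, p): among
    x, x + 1, x + 2, ... exactly the terms of index r + n p are divisible by
    p, and they are p (x' + n). *)
Definition dwork_step (p : nat) (x x' : rat) (r : nat) : Prop :=
  [/\ (r < p)%N, x + r%:R = p%:R * x', x' \in pint p, 0 < x & 0 < x'].

Lemma dwork_step1 p : (0 < p)%N -> dwork_step p 1 1 p.-1.
Proof.
move=> p0; split; rewrite ?rpred1 ?ltr01 ?prednK //.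
by rewrite nat1r prednK // mulr1.
Qed.

Lemma dwork_step_pint p x x' r : dwork_step p x x' r -> x \in pint p.
Proof.
case=> _ /(canRL (addrK _)) -> x'p _ _.
by rewrite rpredB ?rpredM ?rpred_nat.
Qed.

(** The factors of the rising factorial that are units at p. *)
Definition upoch (p r : nat) (x : rat) (k : nat) : rat :=
  \prod_(i < k | (i %% p != r)%N) (x + i%:R).

Lemma dwork_step_unit p x x' r i : prime p -> dwork_step p x x' r ->
  (i %% p != r)%N -> x + i%:R \notin pideal p 1.
Proof.
move=> pp [rp xE x'p _ _]; have p0 := prime_gt0 pp; apply: contra => xi.
have : (i%:R : rat) - r%:R \in pideal p 1.
  have -> : (i%:R : rat) - r%:R = (x + i%:R) - (x + r%:R) by ring.
  by rewrite rpredB // xE pideal1M.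
have [ri|ir] := leqP r i.
  by rewrite -natrB // pideal_nat // expn1 -eqn_mod_dvd // (modn_small rp).
rewrite -opprB rpredN -natrB 1?ltnW // pideal_nat // expn1.
by rewrite -eqn_mod_dvd 1?ltnW // (modn_small rp) eq_sym.
Qed.

Lemma dwork_step_unitV p x x' r i : prime p -> dwork_step p x x' r ->
  (i %% p != r)%N -> (x + i%:R)^-1 \in pint p.
Proof.
move=> pp xs ir; have xp := dwork_step_pint xs.
have /(pint_unit pp)[] := dwork_step_unit pp xs ir; last by [].
by rewrite rpredD ?rpred_nat.
Qed.

Lemma upoch_pint p x x' r k : dwork_step p x x' r -> upoch p r x k \in pint p.
Proof.
move=> xs; apply: rpred_prod => i _.
by rewrite rpredD ?rpred_nat ?(dwork_step_pint xs).
Qed.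

Lemma upochV_pint p x x' r k : prime p -> dwork_step p x x' r ->
  (upoch p r x k)^-1 \in pint p.
Proof.
by move=> pp xs; rewrite -prodfV rpred_prod // => i /(dwork_step_unitV pp xs).
Qed.

Lemma dwork_step_neq0 p x x' r i : dwork_step p x x' r -> x + i%:R != 0.
Proof. by case=> _ _ _ x0 _; rewrite gt_eqF // ltr_wpDr ?ler0n. Qed.

Lemma dwork_step_neq0' p x x' r i : dwork_step p x x' r -> x' + i%:R != 0.
Proof. by case=> _ _ _ _ x0; rewrite gt_eqF // ltr_wpDr ?ler0n. Qed.

Lemma upoch_neq0 p x x' r k : dwork_step p x x' r -> upoch p r x k != 0.
Proof. by move=> xs; apply/prodf_neq0 => i _; apply: dwork_step_neq0 xs. Qed.

Lemma dwork_step_mulE p x x' r n :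
  dwork_step p x x' r -> x + (r + n * p)%:R = p%:R * (x' + n%:R).
Proof. by case=> _ xE _ _ _; rewrite natrD natrM addrA xE; ring. Qed.

Lemma pochhammerS x k : pochhammer x k.+1 = pochhammer x k * (x + k%:R).
Proof. by rewrite /pochhammer big_ord_recr. Qed.

(** When r < v, the last incomplete block of indices contributes one more
    multiple of p to the rising factorial. *)
Definition dwork_extra (p r : nat) (x' : rat) (v u : nat) : rat :=
  if (r < v)%N then p%:R * (x' + u%:R) else 1.

(** Splits the factors into multiples of p, which form the rising factorial of
    x', and units. *)
Lemma pochhammer_dwork_step p x x' r u v : dwork_step p x x' r -> (v <= p)%N ->
  pochhammer x (v + u * p) =
  p%:R ^+ u * pochhammer x' u * dwork_extra p r x' v u * upoch p r x (v + u * p).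
Proof.
move=> xs vp; have [rp _ _ _ _] := xs.
rewrite /pochhammer (bigID (fun i : 'I__ => (i %% p == r)%N)) /=.
rewrite (big_residue _ (fun i => x + i%:R)) //; congr (_ * _ * _).
  rewrite -[X in _ = p%:R ^+ X * _]card_ord -prodr_const -big_split /=.
  by apply: eq_bigr => i _; exact: dwork_step_mulE xs.
by rewrite /dwork_extra; case: ifP => // _; exact: dwork_step_mulE xs.
Qed.

Lemma pochhammer1 k : pochhammer 1 k = k`!%:R.
Proof.
elim: k => [|k IHk]; first by rewrite /pochhammer big_ord0.
by rewrite pochhammerS IHk factS natrM nat1r mulrC.
Qed.

Lemma fact_neq0 k : k`!%:R != 0 :> rat.
Proof. by rewrite pnatr_eq0 -lt0n fact_gt0. Qed.

(** Up to sign the binomial coefficient of -x over k. *)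
Definition pbin (x : rat) (k : nat) : rat := pochhammer x k / k`!%:R.

(** The quotient of the coefficient at v + u p for x by the coefficient at u
    for x'; the powers of p of the two rising factorials cancel. *)
Definition dwork_ratio (p r : nat) (x x' : rat) (v u : nat) : rat :=
  dwork_extra p r x' v u *
    (upoch p r x (v + u * p) / upoch p p.-1 1 (v + u * p)).

Lemma pbin_dwork_step p x x' r u v : dwork_step p x x' r -> (v < p)%N ->
  pbin x (v + u * p) = pbin x' u * dwork_ratio p r x x' v u.
Proof.
move=> xs vp; have p0 : (0 < p)%N by apply: leq_ltn_trans vp.
rewrite /pbin -!pochhammer1 (pochhammer_dwork_step u xs (ltnW vp)).
rewrite (pochhammer_dwork_step u (dwork_step1 p0) (ltnW vp)) /dwork_ratio.
rewrite [dwork_extra p p.-1 _ _ _]/dwork_extra ltnNge -ltnS prednK // vp /=.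
have h1 := upoch_neq0 (v + u * p) (dwork_step1 p0).
have pn : p%:R ^+ u != 0 :> rat by rewrite expf_neq0 // pnatr_eq0 -lt0n.
rewrite pochhammer1; field.
by rewrite h1 pn fact_neq0.
Qed.

Lemma pideal_prodB p k n (f g : nat -> rat) : (0 < p)%N ->
  (forall i, f i \in pint p) -> (forall i, g i \in pint p) ->
  (forall i, f i - g i \in pideal p k) ->
  \prod_(i < n) f i - \prod_(i < n) g i \in pideal p k.
Proof.
move=> p0 fp gp fg; elim: n => [|n IHn]; first by rewrite !big_ord0 subrr rpred0.
rewrite !big_ord_recr /=; set P := \prod_(i < n) f i; set Q := \prod_(i < n) g i.
have -> : P * f n - Q * g n = (P - Q) * f n + Q * (f n - g n) by ring.
by apply: rpredD; [apply: pidealMl|apply: pidealMr]; rewrite // rpred_prod.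
Qed.

(** Functions that gain one power of p: the difference is divisible by p^(t+1)
    when the arguments agree modulo p^t. Already for t = 0 this makes f
    constant modulo p. *)
Definition lip (p : nat) (f : nat -> rat) : Prop :=
  (forall i, f i \in pint p) /\
  (forall t i i', i = i' %[mod p ^ t] -> f i - f i' \in pideal p t.+1).

Lemma lipM p f g : lip p f -> lip p g -> lip p (fun i => f i * g i).
Proof.
move=> [fp fl] [gp gl]; split=> [i|t i i' e]; first by rewrite rpredM.
have -> : f i * g i - f i' * g i' = (f i - f i') * g i + f i' * (g i - g i').
  by ring.
by apply: rpredD; [apply: pidealMl|apply: pidealMr] => //; [apply: fl|apply: gl].
Qed.

Lemma lip_prod p (I : eqType) (s : seq I) (f : I -> nat -> rat) :
  {in s, forall x, lip p (f x)} -> lip p (fun i => \prod_(x <- s) f x i).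
Proof.
move=> fl; split=> [i|t i i' e].
  by rewrite big_seq rpred_prod // => x /fl [].
elim: s fl => [|x s IHs] fl; first by rewrite !big_nil subrr rpred0.
have /fl [xp xl] : x \in x :: s by rewrite mem_head.
have fl' : {in s, forall y, lip p (f y)}.
  by move=> y ys; apply: fl; rewrite inE ys orbT.
rewrite !big_cons; set P := \prod_(y <- s) _; set Q := \prod_(y <- s) _.
have -> : f x i * P - f x i' * Q = (f x i - f x i') * P + f x i' * (P - Q) by ring.
apply: rpredD; last by apply: pidealMr; rewrite ?IHs.
apply: pidealMl; first exact: xl.
by rewrite /P big_seq rpred_prod // => y /fl' [].
Qed.

Section UnitBlocks.
Variables (p : nat) (pp : prime p).
Let p0 : (0 < p)%N := prime_gt0 pp.

Let ufac (c : nat) : rat := if (p %| c)%N then 1 else c%:R.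

Let ufac_int c : ufac c \in pint p.
Proof. by rewrite /ufac; case: ifP; rewrite ?rpred1 ?rpred_nat. Qed.

Let ufac_unit c : ufac c != 0 /\ (ufac c)^-1 \in pint p.
Proof.
rewrite /ufac; case: ifP => [_|/negbT pc]; first by rewrite invr1 rpred1 oner_neq0.
by apply: pint_unit; rewrite ?rpred_nat ?pideal_nat ?expn1.
Qed.

(** Sliding the window by one replaces a factor by a congruent one, so the
    product of the units over a complete residue system does not depend on the
    system. *)
Lemma units_blockE k c :
  \prod_(i < p ^ k.+1) ufac (c + i)%N - \prod_(i < p ^ k.+1) ufac i
    \in pideal p k.+1.
Proof.
set M := (p ^ k.+1)%N; elim: c => [|c IHc].
  by under eq_bigr do rewrite add0n; rewrite subrr rpred0.
apply: pideal_trans IHc.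
set P := \prod_(i < M) ufac (c.+1 + i)%N.
set Q := \prod_(i < M) ufac (c + i)%N.
have [c0 cV] := ufac_unit c.
have PQ : ufac c * P = Q * ufac (c + M).
  transitivity (\prod_(i < M.+1) ufac (c + i)%N).
    by rewrite big_ord_recl /= addn0; congr (_ * _); apply: eq_bigr => i _;
       rewrite /bump /= add1n addSnnS.
  by rewrite big_ord_recr.
have -> : P - Q = (ufac c)^-1 * Q * (ufac (c + M) - ufac c).
  by apply: (mulfI c0); rewrite mulrBr PQ; field.
apply: pidealMr; first by rewrite rpredM // rpred_prod.
rewrite /ufac dvdn_addl; last by rewrite /M expnS dvdn_mulr.
case: ifP => _; first by rewrite subrr rpred0.
by rewrite natrD [c%:R + _]addrC addrK pideal_nat.
Qed.

(** Modulo p^(k+1), x is a natural number n, and x + m + i runs through the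
    complete residue system starting at n + m. *)
Lemma upoch_block k x x' r m : dwork_step p x x' r ->
  \prod_(i < p ^ k.+1)
     (if ((m + i) %% p != r)%N then x + (m + i)%:R else 1)
    - \prod_(i < p ^ k.+1) ufac i \in pideal p k.+1.
Proof.
move=> xs; have xp := dwork_step_pint xs; have [rp xE x'p _ _] := xs.
have [n xn] := pint_residue k.+1 p0 xp.
have pnr : (p %| n + r)%N.
  rewrite -[p]expn1 -pideal_nat // natrD.
  have -> : n%:R + r%:R = (x + r%:R) - (x - n%:R) :> rat by ring.
  by rewrite rpredB // ?xE ?pideal1M // (pideal_le _ _ xn).
apply: pideal_trans (units_blockE k (n + m)).
apply: (@pideal_prodB _ _ _
  (fun i => if ((m + i) %% p != r)%N then x + (m + i)%:R else 1)
  (fun i => ufac (n + m + i))) => //.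
  by move=> i; case: ifP; rewrite ?rpred1 // rpredD ?rpred_nat.
move=> i; rewrite /ufac.
have -> : (p %| n + m + i)%N = ((m + i) %% p == r)%N.
  rewrite -(modn_small rp) -[_ == _](eqn_modDl n) -addnA.
  by rewrite [X in _ == X](eqP pnr).
case: eqP => _ /=; first by rewrite subrr rpred0.
suff -> : x + (m + i)%:R - (n + m + i)%:R = x - n%:R by [].
by rewrite !natrD; ring.
Qed.

(** A block of p^(t+1) consecutive factors contributes the same product modulo
    p^(t+1) to the numerator and to the denominator, so it changes the
    quotient by a factor congruent to 1. *)
Lemma upoch_ratio_lip x x' r t m n : dwork_step p x x' r ->
  m = n %[mod p ^ t.+1] ->
  upoch p r x m / upoch p p.-1 1 m - upoch p r x n / upoch p p.-1 1 n
    \in pideal p t.+1.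
Proof.
move=> xs; have s1 := dwork_step1 p0.
pose V k := upoch p r x k / upoch p p.-1 1 k.
have VM k : V (k + p ^ t.+1)%N - V k \in pideal p t.+1.
  have split y q : upoch p q y (k + p ^ t.+1) = upoch p q y k *
    \prod_(i < p ^ t.+1) (if ((k + i) %% p != q)%N then y + (k + i)%:R else 1).
    by rewrite /upoch big_split_ord /=; congr (_ * _); rewrite big_mkcond.
  rewrite /V !split; have := upoch_block t k xs; have := upoch_block t k s1.
  set W := \prod_(i < _) ufac i.
  set X := \prod_(i < _) _; set Y := \prod_(i < _) _ => WX WY.
  have W1 : W \notin pideal p 1.
    have [W0 WV] : W != 0 /\ W^-1 \in pint p.
      split; first by apply/prodf_neq0 => i _; have [] := ufac_unit i.
      by rewrite -prodfV rpred_prod // => i _; have [] := ufac_unit i.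
    apply/negP => /(pidealMr WV); rewrite mulVf //.
    by rewrite -[1]/(1%:R) pideal_nat // expn1 Euclid_dvd1.
  have Xp : X \in pint p.
    by apply: rpred_prod => i _; case: ifP; rewrite ?rpredD ?rpred_nat ?rpred1.
  have [X0 XV] : X != 0 /\ X^-1 \in pint p.
    apply: (pint_unit pp) => //; apply: contra W1 => X1.
    by rewrite -[W](subKr X) rpredB // (pideal_le _ _ WX).
  have U0 := upoch_neq0 k s1.
  have -> : upoch p r x k * Y / (upoch p p.-1 1 k * X) -
     upoch p r x k / upoch p p.-1 1 k =
     upoch p r x k * (upoch p p.-1 1 k)^-1 * X^-1 * ((Y - W) - (X - W)).
    by field; rewrite U0 X0.
  apply: pidealMr; last by rewrite rpredB.
  by rewrite !rpredM // ?(upoch_pint _ xs) ?(upochV_pint _ pp s1).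
wlog le_nm : m n / (n <= m)%N => [hw e|e].
  have [nm|mn] := leqP n m; first exact: hw.
  by rewrite -opprB rpredN; apply: hw => //; apply: ltnW.
have /dvdnP[q mE] : (p ^ t.+1 %| m - n)%N by rewrite -eqn_mod_dvd //; apply/eqP.
rewrite -[m](subnK le_nm) mE addnC; elim: q {mE} => [|q IHq].
  by rewrite mul0n addn0 subrr rpred0.
rewrite mulSn addnCA addnC; apply: pideal_trans IHq; exact: VM.
Qed.

(** The extra factor p (x' + u) is p times a Lipschitz function, and v + u p
    modulo p^(t+1) depends only on u modulo p^t. *)
Lemma dwork_ratio_lip x x' r v : dwork_step p x x' r -> lip p (dwork_ratio p r x x' v).
Proof.
move=> xs; have s1 := dwork_step1 p0; have [_ _ x'p _ _] := xs; apply: lipM; split.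
- by move=> i; rewrite /dwork_extra; case: ifP; rewrite ?rpred1 // rpredM ?rpredD ?rpred_nat.
- move=> t i j e; rewrite /dwork_extra; case: ifP => _; last by rewrite subrr rpred0.
  rewrite -mulrBr opprD addrACA subrr add0r -[p%:R]expr1 -[t.+1]add1n.
  by apply: pidealM; [apply: pideal_exp|apply: natr_eqmod_pideal].
- by move=> i; rewrite rpredM ?(upoch_pint _ xs) ?(upochV_pint _ pp s1).
- move=> t i j e; apply: (upoch_ratio_lip xs); apply/eqP; rewrite eqn_modDl.
  by rewrite expnS (mulnC p) -!muln_modl e.
Qed.

End UnitBlocks.

(** * Harmonic sums and products over the parameters *)

Definition harm (x : rat) (k : nat) : rat :=
  \sum_(i < k) ((x + i%:R)^-1 - (1 + i%:R)^-1).

(** Only the terms whose denominators are divisible by p matter, and those are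
    1 / (p (x' + n)). *)
Lemma sumV_dwork_step p x x' r u v : prime p -> dwork_step p x x' r -> (v <= p)%N ->
  p%:R * (\sum_(i < v + u * p) (x + i%:R)^-1)
   - (\sum_(i < u) (x' + i%:R)^-1 + (if (r < v)%N then (x' + u%:R)^-1 else 0))
   \in pideal p 1.
Proof.
move=> pp xs vp; have p0 := prime_gt0 pp; have [rp _ _ _ _] := xs.
have pn0 : p%:R != 0 :> rat by rewrite pnatr_eq0 -lt0n.
rewrite (bigID (fun i : 'I__ => (i %% p == r)%N)) /=.
rewrite (big_residue _ (fun i => (x + i%:R)^-1)) //=.
have resE n : (x + (r + n * p)%:R)^-1 = p%:R^-1 * (x' + n%:R)^-1.
  by rewrite (dwork_step_mulE _ xs) invfM.
under eq_bigr do rewrite resE; rewrite resE -mulr_sumr.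
set S := \sum_(i < u) _; set E := \sum_(i < _ | _) _.
have E_int : E \in pint p by apply: rpred_sum => i; apply: dwork_step_unitV pp xs.
suff -> : p%:R * (p%:R^-1 * S + (if (r < v)%N then p%:R^-1 * (x' + u%:R)^-1 else 0)
    + E) - (S + (if (r < v)%N then (x' + u%:R)^-1 else 0)) = p%:R * E.
  exact: pideal1M.
by case: ifP => _; rewrite !mulrDr !mulVKf ?mulr0 //; ring.
Qed.

(** The sums for x and for 1 obey the same rule; the parameter 1 has r = p -
    1, hence never an extra term. *)
Lemma harm_dwork_step p x x' r u v : prime p -> dwork_step p x x' r -> (v < p)%N ->
  p%:R * harm x (v + u * p)
   - (harm x' u + (if (r < v)%N then (x' + u%:R)^-1 else 0)) \in pideal p 1.
Proof.
move=> pp xs vp; have p0 := prime_gt0 pp.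
have := rpredB (sumV_dwork_step u pp xs (ltnW vp))
  (sumV_dwork_step u pp (dwork_step1 p0) (ltnW vp)).
have -> : (p.-1 < v)%N = false by apply/negbTE; rewrite -leqNgt -ltnS prednK.
rewrite addr0 /harm !sumrB.
set a := \sum_(i < _) _; set b := \sum_(i < _) _; set c := \sum_(i < _) _.
set d := \sum_(i < _) _; set e := (if _ then _ else _) => h.
suff -> : p%:R * (a - c) - (b - d + e) = p%:R * a - (b + e) - (p%:R * c - d).
  exact: h.
ring.
Qed.

Lemma dwork_step_exists p x : prime p -> x \in pint p -> 0 < x ->
  exists x', exists r, dwork_step p x x' r.
Proof.
move=> pp xp x0; have p0 := prime_gt0 pp; have [n xn] := pint_residue 1 p0 xp.
have pn0 : p%:R != 0 :> rat by rewrite pnatr_eq0 -lt0n.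
pose r := ((p - n %% p) %% p)%N.
have pr : (p %| n + r)%N.
  rewrite /dvdn /r modnDmr addnBA ?(ltnW (ltn_pmod _ _)) // addnC -addnBA ?leq_mod //.
  by rewrite modnDl /= {1}(divn_eq n p) addnK modnMl.
have xr : x + r%:R \in pideal p 1.
  have -> : x + r%:R = (x - n%:R) + (n + r)%:R by rewrite natrD; ring.
  by rewrite rpredD // pideal_nat.
exists ((x + r%:R) / p%:R), r; split=> //; first by rewrite ltn_pmod.
- by rewrite mulrC divfK.
- by rewrite divr_gt0 ?ltr0n // ltr_wpDr ?ler0n.
Qed.

Lemma pbin0 x : pbin x 0 = 1.
Proof. by rewrite /pbin /pochhammer big_ord0 divr1. Qed.

(** Induction on the number of base-p digits of k. *)
Lemma pbin_pint p x k : prime p -> x \in pint p -> 0 < x -> pbin x k \in pint p.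
Proof.
move=> pp; have p1 := prime_gt1 pp; have p0 := prime_gt0 pp.
elim/ltn_ind: k x => -[|k] IHk x xp x0; first by rewrite pbin0 rpred1.
have [x' [r xs]] := dwork_step_exists pp xp x0; have [_ _ x'p _ x'0] := xs.
rewrite (divn_eq k.+1 p) addnC (pbin_dwork_step _ xs) ?ltn_pmod //.
have [h _] := dwork_ratio_lip pp (k.+1 %% p) xs.
by rewrite rpredM // IHk // ltn_Pdiv.
Qed.

Definition hcoef (I : Type) (s : seq I) (x : I -> rat) (k : nat) : rat :=
  \prod_(e <- s) pbin (x e) k.

Definition hharm (I : Type) (s : seq I) (x : I -> rat) (k : nat) : rat :=
  \sum_(e <- s) harm (x e) k.

(** Each summand w e may have a denominator, provided that the factor f e of
    the product absorbs it. *)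
Lemma prod_sum_pideal p k (I : eqType) (s : seq I) (f w : I -> rat) :
  {in s, forall e, f e \in pint p} ->
  {in s, forall e, f e * w e \in pideal p k} ->
  \prod_(e <- s) f e * \sum_(e <- s) w e \in pideal p k.
Proof.
elim: s => [|e t IHt] fp fw; first by rewrite !big_nil mulr0 rpred0.
have in_t y : y \in t -> y \in e :: t by rewrite inE => ->; rewrite orbT.
rewrite !big_cons; set P := \prod_(y <- t) _; set W := \sum_(y <- t) _.
have -> : f e * P * (w e + W) = f e * w e * P + f e * (P * W) by ring.
apply: rpredD.
  apply: pidealMl; first by apply: fw; rewrite mem_head.
  by rewrite /P big_seq rpred_prod // => y /in_t /fp.
apply: pidealMr; first by apply: fp; rewrite mem_head.
by apply: IHt => y /in_t; [apply: fp | apply: fw].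
Qed.

Section MultiParameters.
Variables (p : nat) (pp : prime p) (I : eqType) (s : seq I).
Variables (x x' : I -> rat) (r : I -> nat).
Hypothesis xs : {in s, forall e, dwork_step p (x e) (x' e) (r e)}.

Definition hratio (v u : nat) : rat :=
  \prod_(e <- s) dwork_ratio p (r e) (x e) (x' e) v u.

Lemma hratio_lip v : lip p (hratio v).
Proof. by apply: lip_prod => e /xs; apply: dwork_ratio_lip. Qed.

Lemma hcoef_dwork_step v u : (v < p)%N ->
  hcoef s x (v + u * p) = hcoef s x' u * hratio v u.
Proof.
move=> vp; rewrite /hcoef /hratio -big_split /=; apply: eq_big_seq => e /xs es.
exact: pbin_dwork_step.
Qed.

Lemma hcoef_pint k : hcoef s x k \in pint p.
Proof.
rewrite /hcoef big_seq; apply: rpred_prod => e /xs es.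
by apply: pbin_pint => //; [exact: dwork_step_pint es | case: es].
Qed.

Lemma hcoef_pint' k : hcoef s x' k \in pint p.
Proof.
rewrite /hcoef big_seq; apply: rpred_prod => e /xs es.
by apply: pbin_pint; case: es.
Qed.

(** An extra term 1 / (x' + u) is absorbed by the factor p (x' + u) that
    appears in the ratio under the same condition r < v. *)
Lemma hharm_dwork_step v u : (v < p)%N ->
  hcoef s x (v + u * p) * (p%:R * hharm s x (v + u * p) - hharm s x' u)
    \in pideal p 1.
Proof.
move=> vp; have p0 := prime_gt0 pp.
rewrite (hcoef_dwork_step u vp) -mulrA; apply: pidealMr; first exact: hcoef_pint'.
rewrite /hharm mulr_sumr -sumrB; apply: prod_sum_pideal => e /xs es.
  by have [] := dwork_ratio_lip pp v es.
have := harm_dwork_step u pp es vp; set a := p%:R * _; set b := harm _ u.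
set c := (if _ then _ else _) => h.
have [rho_int _] := dwork_ratio_lip pp v es.
have -> : a - b = (a - (b + c)) + c by ring.
rewrite mulrDr; apply: rpredD; first exact: pidealMr.
rewrite /c /dwork_ratio /dwork_extra; case: ifP => _; last by rewrite mulr0 rpred0.
have x'0 := dwork_step_neq0' u es.
set y := x' e + _ in x'0 *; set q := upoch _ _ _ _ / _.
have -> : p%:R * y * q * y^-1 = p%:R * q by field.
apply: pideal1M => //.
by rewrite rpredM // ?(upoch_pint _ es) // (upochV_pint _ pp (dwork_step1 p0)).
Qed.

End MultiParameters.

(** * The symmetrised convolution sum *)

Lemma sum_digit (V : nmodType) p n (f : nat -> V) :
  \sum_(j < n * p) f j = \sum_(c < p) \sum_(i < n) f (c + i * p)%N.
Proof.
rewrite -(big_mkord xpredT) big_nat_mul big_mkord exchange_big /=.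
apply: eq_bigr => i _; rewrite -{1}[(i * p)%N]add0n big_addn mulSn addnK.
by rewrite big_mkord.
Qed.

(** The two-variable version of the gain of one power of p. *)
Definition lip2 (p : nat) (f : nat -> nat -> rat) : Prop :=
  (forall i j, f i j \in pint p) /\
  (forall t i i' j j', i = i' %[mod p ^ t] -> j = j' %[mod p ^ t] ->
     f i j - f i' j' \in pideal p t.+1).

Lemma lip2M p f g : lip2 p f -> lip2 p g -> lip2 p (fun i j => f i j * g i j).
Proof.
move=> [fp fl] [gp gl]; split=> [i j|t i i' j j' ei ej]; first by rewrite rpredM.
have -> : f i j * g i j - f i' j' * g i' j' =
   (f i j - f i' j') * g i j + f i' j' * (g i j - g i' j') by ring.
by apply: rpredD; [apply: pidealMl|apply: pidealMr] => //; [apply: fl|apply: gl].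
Qed.

Lemma lip_lip2l p f : lip p f -> lip2 p (fun i _ => f i).
Proof. by case=> h1 h2; split=> // t i i' _ _ e _; apply: h2. Qed.

Lemma lip_lip2r p f : lip p f -> lip2 p (fun _ j => f j).
Proof. by case=> h1 h2; split=> // t _ _ j j' _ e; apply: h2. Qed.

(** Divided difference along the last base-p digits c and c'. It is integral
    because f is constant modulo p, and it inherits the gain because the
    arguments c + i p agree modulo p^(t+1) when i agrees modulo p^t. *)
Definition dquot (p : nat) (f : nat -> nat -> rat) (c c' i j : nat) : rat :=
  (f (c + i * p)%N (c' + j * p)%N - f 0%N 0%N) / p%:R.

Lemma lip2_dquot p f c c' : lip2 p f -> lip2 p (dquot p f c c').
Proof.
move=> [fp fl]; split=> [i j|t i i' j j' ei ej].
  have := fl 0%N (c + i * p)%N 0%N (c' + j * p)%N 0%N.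
  by rewrite !modn1 => /(_ erefl erefl).
rewrite /dquot -mulrBl opprB addrA subrK pidealE -mulrA -invfM -exprS.
apply: (fl t.+1); rewrite expnS [(p * _)%N]mulnC; apply/eqP;
  by rewrite eqn_modDl -!muln_modl ?ei ?ej.
Qed.

Section DworkSum.
Variables (p : nat) (pp : prime p).
Variables (A h : nat -> rat) (R : nat -> nat -> rat).
Hypothesis A_int : forall k, A k \in pint p.
Hypothesis A_rec : forall v u, (v < p)%N -> A (v + u * p)%N = A u * R v u.
Hypothesis R_lip : forall v, lip p (R v).
Hypothesis Ah_rec : forall v u, (v < p)%N ->
  A (v + u * p)%N * (p%:R * h (v + u * p)%N - h u) \in pideal p 1.

(** The denominators of h j, of unbounded order in p, are compensated by the
    antisymmetrisation of f. *)
Definition dwork_sum (e K : nat) (f : nat -> nat -> rat) : rat :=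
  \sum_(j < p ^ e) \sum_(l < p ^ e)
    (if (j + l == K)%N then A j * A l * h j * (f j l - f l j) else 0).

(** Write j = c + i p and l = c' + l' p. Then A j h j is A i R c i h i / p
    up to p^-1 times an element of the ideal, while f j l - f l j is p times
    a difference of divided differences; the two powers of p cancel.
    Exchanging c and c' in the second half of the sum turns what is left
    into sums of the same shape with one digit less, for the functions R c i
    * R c' l * dquot. *)
Lemma dwork_sum_pideal e K f : lip2 p f -> dwork_sum e K f \in pideal p 1.
Proof.
have p0 := prime_gt0 pp; have pn0 : p%:R != 0 :> rat by rewrite pnatr_eq0 -lt0n.
elim: e K f => [|e IHe] K f fl.
  by rewrite /dwork_sum expn0 !big_ord1 subrr mulr0 if_same rpred0.
(* g c c' is the function of the sum with one digit less. *)
pose g c c' i l := R c i * R c' l * dquot p f c c' i l.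
have gl c c' : lip2 p (g c c').
  apply: lip2M (lip2_dquot _ _ fl).
  exact: lip2M (lip_lip2l (R_lip c)) (lip_lip2r (R_lip c')).
pose W c c' (w : nat -> nat -> rat) := \sum_(i < p ^ e) \sum_(l < p ^ e)
  (if (c + i * p + (c' + l * p) == K)%N then A i * A l * h i * w i l else 0).
pose T1 c c' := W c c' (g c c').
pose T2 c c' := W c c' (fun i l => g c c' l i).
have T12 c c' : T1 c c' - T2 c c' \in pideal p 1.
  have -> : T1 c c' - T2 c c' = W c c' (fun i l => g c c' i l - g c c' l i).
    rewrite /T1 /T2 /W -sumrB; apply: eq_bigr => i _; rewrite -sumrB.
    by apply: eq_bigr => l _; case: ifP => _; rewrite ?subrr // mulrBr.
  (* The last digits c, c' are possible only if K - (c + c') = K' p. *)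
  have [/andP[cK /dvdnP[K' KE]]|nK] :=
      boolP ((c + c' <= K) && (p %| K - (c + c')))%N.
    suff -> : W c c' (fun i l => g c c' i l - g c c' l i) =
       dwork_sum e K' (g c c') by apply: IHe.
    apply: eq_bigr => i _; apply: eq_bigr => l _.
    suff -> : (c + i * p + (c' + l * p) == K)%N = (i + l == K')%N by [].
    rewrite -(subnK cK) KE addnACA addnC eqn_add2r -mulnDl.
    by rewrite eqn_pmul2r.
  rewrite /W big1 ?rpred0 // => i _; rewrite big1 // => l _.
  case: eqP => // KE; case/negP: nK; rewrite -KE addnACA leq_addr addKn.
  by rewrite -mulnDl dvdn_mull.
pose X (c c' : nat) : rat := \sum_(i < p ^ e) \sum_(l < p ^ e)
  (if (c + i * p + (c' + l * p) == K)%N then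
    A (c + i * p)%N * A (c' + l * p)%N * h (c + i * p)%N *
     (f (c + i * p)%N (c' + l * p)%N - f (c' + l * p)%N (c + i * p)%N) else 0).
have -> : dwork_sum e.+1 K f = \sum_(c < p) \sum_(c' < p) X c c'.
  rewrite /dwork_sum expnSr.
  pose F j l := if (j + l == K)%N then A j * A l * h j * (f j l - f l j) else 0.
  rewrite (sum_digit p _ (fun j => \sum_(l < p ^ e * p) F j l)).
  apply: eq_bigr => c _; under eq_bigr do rewrite (sum_digit p _ (F _)).
  by rewrite exchange_big.
(* T2 at (c', c): exchanging the digits restores the antisymmetry. *)
have XT (c c' : 'I_p) : X c c' - (T1 c c' - T2 c' c) \in pideal p 1.
  rewrite /X /T1 /T2 /W -!sumrB; apply: rpred_sum => i _.
  rewrite -!sumrB; apply: rpred_sum => l _.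
  rewrite [(c' + _ + _)%N]addnACA [(c' + c)%N]addnC -addnACA.
  case: ifP => _; last by rewrite !subr0 rpred0.
  set a := A (c + i * p)%N; set b := A (c' + l * p)%N.
  set D := dquot p f c c' i l - dquot p f c' c l i.
  set eps := a * (p%:R * h (c + i * p)%N - h i).
  suff -> : a * b * h (c + i * p)%N *
     (f (c + i * p)%N (c' + l * p)%N - f (c' + l * p)%N (c + i * p)%N) -
     (A i * A l * h i * g c c' i l - A i * A l * h i * g c' c l i) = eps * (b * D).
    apply: pidealMl; first exact: Ah_rec.
    have [h1 _] := lip2_dquot c c' fl; have [h2 _] := lip2_dquot c' c fl.
    by rewrite rpredM // ?rpredB // A_int.
  rewrite /eps /g /a /b !A_rec // /D /dquot; field; exact: pn0.
have -> : \sum_(c < p) \sum_(c' < p) X c c' =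
  \sum_(c < p) \sum_(c' < p) (X c c' - (T1 c c' - T2 c' c)) +
  \sum_(c < p) \sum_(c' < p) (T1 c c' - T2 c c').
  under [X in _ = _ + X]eq_bigr do rewrite sumrB.
  rewrite sumrB [X in _ + (_ - X)]exchange_big -sumrB -big_split /=.
  apply: eq_bigr => c _; rewrite -sumrB -big_split /=.
  by apply: eq_bigr => c' _; rewrite subrK.
by apply: rpredD; do 2! (apply: rpred_sum => ? _).
Qed.

End DworkSum.

(** * The ring of formal power series *)

HB.instance Definition _ := gen_eqMixin fps.
HB.instance Definition _ := gen_choiceMixin fps.

Definition fps_zero : fps := fun=> 0.
Definition fps_opp (f : fps) : fps := fun n => - f n.
Definition fps_add (f g : fps) : fps := fun n => f n + g n.

Fact fps_addA : associative fps_add.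
Proof. by move=> f g h; apply/funext => n; apply: addrA. Qed.
Fact fps_addC : commutative fps_add.
Proof. by move=> f g; apply/funext => n; apply: addrC. Qed.
Fact fps_add0 : left_id fps_zero fps_add.
Proof. by move=> f; apply/funext => n; apply: add0r. Qed.
Fact fps_addN : left_inverse fps_zero fps_opp fps_add.
Proof. by move=> f; apply/funext => n; apply: addNr. Qed.

HB.instance Definition _ :=
  GRing.isZmodule.Build fps fps_addA fps_addC fps_add0 fps_addN.

(** Associativity and commutativity of the Cauchy product are inherited from
    polynomials, which compute it up to degree n. *)
Definition ptrunc (n : nat) (f : fps) : {poly rat} := \poly_(i < n.+1) f i.

Lemma coef_ptrunc n f i : (i <= n)%N -> (ptrunc n f)`_i = f i.
Proof. by move=> le_in; rewrite coef_poly ltnS le_in. Qed.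

Lemma fps_mulE f g n i : (i <= n)%N ->
  fps_mul f g i = (ptrunc n f * ptrunc n g)`_i.
Proof.
move=> le_in; rewrite coefM; apply: eq_bigr => j _.
have le_ji : (j <= i)%N by rewrite -ltnS.
by rewrite !coef_ptrunc ?(leq_trans _ le_in) // leq_subr.
Qed.

Fact fps_mulA : associative fps_mul.
Proof.
move=> f g h; apply/funext => n.
transitivity ((ptrunc n f * (ptrunc n g * ptrunc n h))`_n).
  rewrite coefM; apply: eq_bigr => i _; rewrite -fps_mulE ?leq_subr //.
  by rewrite coef_ptrunc -1?ltnS.
rewrite mulrA coefM; apply: eq_bigr => i _; rewrite -fps_mulE -1?ltnS //.
by rewrite coef_ptrunc ?leq_subr.
Qed.

Fact fps_mulC : commutative fps_mul.
Proof.
by move=> f g; apply/funext => n; rewrite !(@fps_mulE _ _ n) // mulrC.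
Qed.

Fact fps_mul1 : left_id fps_one fps_mul.
Proof.
move=> f; apply/funext => n; rewrite /fps_mul big_ord_recl subn0 mul1r.
by rewrite big1 ?addr0 // => i _; rewrite mul0r.
Qed.

Fact fps_mulDl : left_distributive fps_mul fps_add.
Proof.
move=> f g h; apply/funext => n; rewrite /fps_mul /fps_add -big_split.
by apply: eq_bigr => i _; apply: mulrDl.
Qed.

Fact fps_one_neq0 : fps_one != 0.
Proof.
apply/eqP => /(congr1 (fun f : fps => f 0%N)) /eqP.
by rewrite /fps_one oner_eq0.
Qed.

HB.instance Definition _ := GRing.Zmodule_isComNzRing.Build fps
  fps_mulA fps_mulC fps_mul1 fps_mulDl fps_one_neq0.

Lemma fpsD (f g : fps) n : (f + g) n = f n + g n. Proof. by []. Qed.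
Lemma fpsN (f : fps) n : (- f) n = - f n. Proof. by []. Qed.
Lemma fpsB (f g : fps) n : (f - g) n = f n - g n. Proof. by []. Qed.
Lemma fpsM (f g : fps) n : (f * g) n = \sum_(i < n.+1) f i * g (n - i)%N.
Proof. by []. Qed.
Lemma fps1 n : (1 : fps) n = (n == 0%N)%:R. Proof. by []. Qed.
Lemma fps0 n : (0 : fps) n = 0. Proof. by []. Qed.
Lemma fps_powE (f : fps) k : fps_pow f k = f ^+ k.
Proof. by elim: k => [|k IHk] //; rewrite exprS -IHk. Qed.

Lemma fps_sumE (I : Type) (s : seq I) (P : pred I) (f : I -> fps) n :
  (\sum_(i <- s | P i) f i) n = \sum_(i <- s | P i) f i n.
Proof. by elim/big_rec2: _ => // i x y _ <-. Qed.

Lemma fpsMn (f : fps) k n : (f *+ k) n = f n *+ k.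
Proof. by elim: k => [|k IHk] //; rewrite !mulrS -IHk. Qed.

Lemma fpsM0 (f g : fps) : (f * g) 0%N = f 0%N * g 0%N.
Proof. by rewrite fpsM big_ord1. Qed.

Lemma fpsX0 (f : fps) k : (f ^+ k) 0%N = f 0%N ^+ k.
Proof. by elim: k => // k IHk; rewrite !exprS fpsM0 IHk. Qed.

Definition fint (p : nat) : {pred fps} :=
  [pred f : fps | `[< forall n, f n \in pint p >]].

Lemma fintP p f : reflect (forall n, f n \in pint p) (f \in fint p).
Proof. exact: asboolP. Qed.

Fact fint_subring p : subring_closed (fint p).
Proof.
split=> [|f g|f g].
- by apply/fintP => n; rewrite fps1 rpred_nat.
- by move=> /fintP fp /fintP gp; apply/fintP => n; rewrite fpsB rpredB.
- move=> /fintP fp /fintP gp; apply/fintP => n.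
  by rewrite fpsM rpred_sum // => i _; rewrite rpredM.
Qed.
HB.instance Definition _ p :=
  GRing.isSubringClosed.Build fps (fint p) (fint_subring p).

Definition fideal (p k : nat) : {pred fps} :=
  [pred f : fps | `[< forall n, f n \in pideal p k >]].

Lemma fidealP p k f : reflect (forall n, f n \in pideal p k) (f \in fideal p k).
Proof. exact: asboolP. Qed.

Fact fideal_zmod p k : zmod_closed (fideal p k).
Proof.
split=> [|f g]; first by apply/fidealP => n; rewrite fps0 rpred0.
by move=> /fidealP fp /fidealP gp; apply/fidealP => n; rewrite fpsB rpredB.
Qed.
HB.instance Definition _ p k :=
  GRing.isZmodClosed.Build fps (fideal p k) (fideal_zmod p k).

Lemma fidealM p k l f g : f \in fideal p k -> g \in fideal p l ->
  f * g \in fideal p (k + l).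
Proof.
move=> /fidealP fp /fidealP gp; apply/fidealP => n.
by rewrite fpsM rpred_sum // => i _; apply: pidealM.
Qed.

Lemma fps_mul_agree n (f f' g g' : fps) :
  (forall i, (i <= n)%N -> f i = f' i) -> (forall i, (i <= n)%N -> g i = g' i) ->
  (f * g) n = (f' * g') n.
Proof.
move=> ff gg; rewrite !fpsM; apply: eq_bigr => i _.
by rewrite ff -1?ltnS // gg // leq_subr.
Qed.

(** The derivation z d/dz. *)
Definition fder (f : fps) : fps := fun n => n%:R * f n.

Lemma fderM f g : fder (f * g) = fder f * g + f * fder g.
Proof.
apply/funext => n; rewrite fpsD !fpsM /fder mulr_sumr -big_split /=.
apply: eq_bigr => i _; have le_in : (i <= n)%N by rewrite -ltnS.
have -> : n%:R = i%:R + (n - i)%:R :> rat by rewrite -natrD subnKC.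
ring.
Qed.

Lemma fderD f g : fder (f + g) = fder f + fder g.
Proof. by apply/funext => n; rewrite /fder !fpsD mulrDr. Qed.

Lemma fderX f k : fder (f ^+ k) = f ^+ k.-1 * fder f *+ k.
Proof.
elim: k => [|k IHk]; first by apply/funext => -[|n]; rewrite /fder ?mul0r ?mulr0.
rewrite exprS fderM IHk /= mulrnAr mulrA -exprS mulrS mulrC; congr (_ + _).
by case: k {IHk} => [|k]; rewrite ?mulr0n.
Qed.

(** In degree n > 0 the equation reads n f_n = sum of f_i S_(n-i) over i < n,
    because S_0 = 0. *)
Lemma fder_uniq (f g S : fps) : S 0%N = 0 -> f 0%N = g 0%N ->
  fder f = f * S -> fder g = g * S -> f = g.
Proof.
move=> S0 fg0 fS gS; apply/funext; elim/ltn_ind=> -[//|n] IHn.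
have /(congr1 (fun u : fps => u n.+1)) := fS; rewrite {1}/fder fpsM.
rewrite big_ord_recr /= subnn S0 mulr0 addr0 => fE.
have /(congr1 (fun u : fps => u n.+1)) := gS; rewrite {1}/fder fpsM.
rewrite big_ord_recr /= subnn S0 mulr0 addr0 => gE.
apply: (@mulfI _ n.+1%:R); rewrite ?pnatr_eq0 // fE gE.
by apply: eq_bigr => i _; rewrite IHn.
Qed.

Lemma fps_expE (f : fps) n M : f 0%N = 0 -> (n <= M)%N ->
  fps_exp f n = \sum_(k < M.+1) (k`!%:R)^-1 * (f ^+ k) n.
Proof.
move=> f0 nM; rewrite /fps_exp /fps_comp.
rewrite (big_ord_widen M.+1 (fun k => (k`!%:R)^-1 * fps_pow f k n)) // big_mkcond.
apply: eq_bigr => k _; rewrite -fps_powE; case: ltnP => // nk.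
by rewrite fps_pow_lt ?mulr0.
Qed.

Lemma fps_exp0 f : fps_exp f 0%N = 1.
Proof. by rewrite /fps_exp /fps_comp big_ord1 /= fact0 invr1 mul1r. Qed.

(** The exponential cut off after finitely many terms, a finite sum to which
    the Leibniz rule applies. *)
Definition fps_exp_sum (M : nat) (f : fps) : fps :=
  fun n => \sum_(k < M) (k`!%:R)^-1 * (f ^+ k) n.

Lemma fder_exp_sum M f : fder (fps_exp_sum M.+1 f) = fps_exp_sum M f * fder f.
Proof.
apply/funext => n; rewrite fpsM {1}/fder /fps_exp_sum big_ord_recl mulrDr.
rewrite expr0 fps1 -[X in X + _]/(n%:R * (_ * _)) [X in X + _](_ : _ = 0); last first.
  by case: n => [|n]; rewrite ?mul0r ?mulr0.
rewrite add0r mulr_sumr; under [RHS]eq_bigr do rewrite mulr_suml.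
rewrite exchange_big; apply: eq_bigr => k _ /=; rewrite /bump add1n.
under [RHS]eq_bigr do rewrite -mulrA; rewrite -mulr_sumr -fpsM mulrCA.
have -> : n%:R * (f ^+ k.+1) n = (f ^+ k * fder f) n * k.+1%:R.
  by rewrite mulr_natr -fpsMn -(fderX f k.+1).
by rewrite factS natrM; field; rewrite fact_neq0 nat1r pnatr_eq0.
Qed.

Lemma fps_exp_sumE (f : fps) M n : f 0%N = 0 -> (n < M)%N ->
  fps_exp_sum M f n = fps_exp f n.
Proof. by case: M => // M f0 nM; rewrite (@fps_expE f n M). Qed.

Lemma fder_exp (f : fps) : f 0%N = 0 -> fder (fps_exp f) = fps_exp f * fder f.
Proof.
move=> f0; apply/funext => n.
transitivity (fder (fps_exp_sum n.+1 f) n); first by rewrite /fder fps_exp_sumE.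
rewrite fder_exp_sum !fpsM !big_ord_recr /= subnn /fder mul0r !mulr0; congr (_ + _).
by apply: eq_bigr => i _; rewrite fps_exp_sumE.
Qed.

(** Both sides solve y' = (f + g)' y. *)
Lemma fps_exp_add (f g : fps) : f 0%N = 0 -> g 0%N = 0 ->
  fps_exp (f + g) = fps_exp f * fps_exp g.
Proof.
move=> f0 g0; have fg0 : (f + g) 0%N = 0 by rewrite fpsD f0 g0 addr0.
apply: (@fder_uniq _ _ (fder (f + g))); rewrite ?fder_exp //.
- by rewrite /fder mul0r.
- by rewrite fpsM0 !fps_exp0 mulr1.
- by rewrite fderM !fder_exp // fderD; ring.
Qed.

Lemma fps_exp_mulrn (f : fps) k : f 0%N = 0 -> fps_exp (f *+ k) = fps_exp f ^+ k.
Proof.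
move=> f0; elim: k => [|k IHk]; last first.
  by rewrite mulrS fps_exp_add ?IHk ?exprS // fpsMn f0 mul0rn.
have fder0 : fder 0 = 0 by apply/funext => n; apply: mulr0.
apply: (@fder_uniq _ _ 0); rewrite ?mulr0n ?fder_exp ?fps_exp0 ?fder0 //.
by rewrite mulr0; apply/funext => -[|n]; rewrite /fder ?mul0r ?mulr0.
Qed.

(** The series f(z^p). *)
Definition stretch (p : nat) (f : fps) : fps :=
  fun n => if (p %| n)%N then f (n %/ p)%N else 0.

Lemma stretch_mulE p f g v K : (v < p)%N ->
  (stretch p f * g) (v + K * p)%N = \sum_(l < K.+1) f l * g (v + (K - l) * p)%N.
Proof.
move=> vp; have p0 : (0 < p)%N by apply: leq_ltn_trans vp.
rewrite fpsM (bigID (fun i : 'I__ => (i %% p == 0)%N)) /= [X in _ + X]big1 ?addr0.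
  rewrite -addSn (big_residue _ (fun i => stretch p f i * g (v + K * p - i)%N)) //=.
  rewrite big_ord_recr /= /stretch !add0n dvdn_mull // mulnK // subnn addnK mul0n addn0.
  congr (_ + _); apply: eq_bigr => i _; rewrite add0n dvdn_mull // mulnK //.
  by rewrite mulnBl addnBA // leq_mul2r (ltnW (ltn_ord i)) orbT.
by move=> i ip; rewrite /stretch /dvdn (negbTE ip) mul0r.
Qed.

Lemma stretchM p f g : (0 < p)%N -> stretch p (f * g) = stretch p f * stretch p g.
Proof.
move=> p0; apply/funext => n; rewrite (divn_eq n p) addnC.
rewrite stretch_mulE ?ltn_pmod // {1}/stretch dvdn_addl ?dvdn_mull //.
rewrite /dvdn modn_mod; case: eqP => [->|/eqP n0].
  rewrite add0n mulnK // fpsM; apply: eq_bigr => i _.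
  by rewrite /stretch add0n dvdn_mull // mulnK.
by rewrite big1 // => i _; rewrite /stretch dvdn_addl ?dvdn_mull //;
   rewrite /dvdn modn_mod (negbTE n0) mulr0.
Qed.

Lemma stretchD p f g : stretch p (f + g) = stretch p f + stretch p g.
Proof.
apply/funext => n; rewrite /stretch !fpsD; by case: ifP => _ //; rewrite addr0.
Qed.

Lemma stretch0 p (f : fps) : stretch p f 0%N = f 0%N.
Proof. by rewrite /stretch dvdn0 div0n. Qed.

Lemma fder_stretch p f : (0 < p)%N -> fder (stretch p f) = stretch p (fder f) *+ p.
Proof.
move=> p0; apply/funext => n; rewrite fpsMn /fder /stretch; case: ifP => [pn|_].
  by rewrite -{1}(divnK pn) natrM -mulr_natr; ring.
by rewrite mulr0 mul0rn.
Qed.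

(** Both sides solve the same linear differential equation. *)
Lemma fps_exp_stretch p (f : fps) : (0 < p)%N -> f 0%N = 0 ->
  stretch p (fps_exp f) = fps_exp (stretch p f).
Proof.
move=> p0 f0; apply: (@fder_uniq _ _ (fder (stretch p f))).
- by rewrite /fder mul0r.
- by rewrite stretch0 !fps_exp0.
- by rewrite !fder_stretch // fder_exp // stretchM // mulrnAr.
- by rewrite fder_exp // stretch0.
Qed.

(** * The Dieudonne-Dwork criterion *)

(** Fermat's little theorem, carried over by reducing c to a natural number
    modulo p. *)
Lemma fermat_pint p c : prime p -> c \in pint p -> c ^+ p - c \in pideal p 1.
Proof.
move=> pp cp; have p0 := prime_gt0 pp; have [n cn] := pint_residue 1 p0 cp.
have np : n%:R \in pint p by rewrite rpred_nat.
apply: (@pideal_trans _ _ (n%:R ^+ p)).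
  rewrite subrXX; apply: pidealMl => //.
  by apply: rpred_sum => i _; rewrite rpredM ?rpredX.
apply: (@pideal_trans _ _ n%:R); last by rewrite -opprB rpredN.
by rewrite -natrX; apply: natr_eqmod_pideal; rewrite // expn1 fermat_little.
Qed.

Lemma fideal_mulrn p k f n : (0 < p)%N -> (p ^ k %| n)%N -> f \in fint p ->
  f *+ n \in fideal p k.
Proof.
move=> p0 pn /fintP fp; apply/fidealP => i; rewrite fpsMn -mulr_natr.
by apply: pidealMr => //; rewrite pideal_nat.
Qed.

Lemma frobenius_add p f g : prime p -> f \in fint p -> g \in fint p ->
  (f + g) ^+ p - (f ^+ p + g ^+ p) \in fideal p 1.
Proof.
case: p => // q pp fp gp; rewrite exprDn big_ord_recl big_ord_recr /=.
rewrite subn0 bin0 expr0 mulr1 /bump add1n subnn expr0 mul1r binn !mulr1n.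
set S := \sum_(i < q) _; set a := f ^+ _; set b := g ^+ _.
have -> : a + (S + b) - (a + b) = S by ring.
apply: rpred_sum => i _; apply: fideal_mulrn => //.
  by rewrite expn1 prime_dvd_bin //= add1n ltnS.
by rewrite rpredM ?rpredX.
Qed.

Definition ftrunc (m : nat) (f : fps) : fps := fun i => if (i < m)%N then f i else 0.

Definition fmono (m : nat) (c : rat) : fps := fun i => if i == m then c else 0.

Lemma fmonoM m n c d : fmono m c * fmono n d = fmono (m + n) (c * d).
Proof.
apply/funext => k; rewrite fpsM /fmono; case: eqP => [->|kmn].
  have mk : (m < (m + n).+1)%N by rewrite ltnS leq_addr.
  rewrite (bigD1 (Ordinal mk)) //= eqxx addKn eqxx big1 ?addr0 // => i.
  by rewrite -val_eqE /= => /negbTE ->; rewrite mul0r.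
rewrite big1 // => i _; case: eqP => [im|]; last by rewrite mul0r.
case: eqP => [kn|]; last by rewrite mulr0.
by case: kmn; rewrite -im -kn subnKC // -ltnS.
Qed.

Lemma fmonoX m c k : fmono m c ^+ k = fmono (m * k) (c ^+ k).
Proof.
elim: k => [|k IHk]; last by rewrite !exprS IHk fmonoM mulnS.
by rewrite muln0 !expr0; apply/funext => -[|n].
Qed.

Lemma stretch_mono p m c : (0 < p)%N -> stretch p (fmono m c) = fmono (m * p) c.
Proof.
move=> p0; apply/funext => n; rewrite /stretch /fmono; case: ifP => [pn|/negP pn].
  by rewrite -{2}(divnK pn) eqn_pmul2r.
by case: eqP => // nE; case: pn; rewrite nE dvdn_mull.
Qed.

Lemma ftruncS m f : ftrunc m.+1 f = ftrunc m f + fmono m (f m).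
Proof.
apply/funext => i; rewrite fpsD /ftrunc /fmono ltnS leq_eqVlt.
by case: ltngtP => //= [|->]; rewrite ?addr0 ?add0r.
Qed.

Lemma ftrunc_int p m f : f \in fint p -> ftrunc m f \in fint p.
Proof.
by move=> /fintP fp; apply/fintP => i; rewrite /ftrunc; case: ifP; rewrite ?rpred0.
Qed.

Lemma fmono_int p m c : c \in pint p -> fmono m c \in fint p.
Proof. by move=> cp; apply/fintP => i; rewrite /fmono; case: ifP; rewrite ?rpred0. Qed.

Lemma fpsX_agree n k (f g : fps) : (forall i, (i <= n)%N -> f i = g i) ->
  (f ^+ k) n = (g ^+ k) n.
Proof.
elim: k n => [|k IHk] n fg; first by rewrite !expr0.
rewrite !exprS; apply: fps_mul_agree => // i le_in; apply: IHk => j le_ji.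
by rewrite fg ?(leq_trans le_ji).
Qed.

Lemma ftrunc_agree n f i : (i <= n)%N -> f i = ftrunc n.+1 f i.
Proof. by rewrite /ftrunc ltnS => ->. Qed.

(** Truncations are finite sums of monomials, and the p-th power is additive
    modulo p; each coefficient only involves a truncation. *)
Lemma frobenius_fint p f : prime p -> f \in fint p ->
  f ^+ p - stretch p f \in fideal p 1.
Proof.
move=> pp fp; have p0 := prime_gt0 pp.
have tr m : ftrunc m f ^+ p - stretch p (ftrunc m f) \in fideal p 1.
  elim: m => [|m IHm].
    have -> : ftrunc 0 f = 0 by apply/funext => i.
    rewrite expr0n gtn_eqF // sub0r rpredN; apply/fidealP => i.
    by rewrite /stretch; case: ifP; rewrite rpred0.
  have fmp : f m \in pint p by move/fintP: fp.
  rewrite ftruncS stretchD stretch_mono //.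
  set A := ftrunc m f in IHm *; set B := fmono m (f m).
  have -> : (A + B) ^+ p - (stretch p A + fmono (m * p) (f m)) =
   ((A + B) ^+ p - (A ^+ p + B ^+ p)) + (A ^+ p - stretch p A) +
      (B ^+ p - fmono (m * p) (f m)) by ring.
  apply: rpredD; first apply: rpredD => //.
    by apply: frobenius_add; rewrite ?ftrunc_int ?fmono_int.
  rewrite fmonoX; apply/fidealP => i; rewrite fpsB /fmono.
  by case: eqP => _; rewrite ?subrr ?rpred0 // fermat_pint.
apply/fidealP => n; rewrite fpsB; have /fidealP/(_ n) := tr n.+1; rewrite fpsB.
rewrite (@fpsX_agree n p f _ (@ftrunc_agree n f)).
suff -> : stretch p f n = stretch p (ftrunc n.+1 f) n by [].
by rewrite /stretch; case: ifP => // _; apply: ftrunc_agree; apply: leq_div.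
Qed.

(** The valuation of k! is less than k; by induction through k! = p^u u! times
    a unit, where u = floor(k / p). *)
Lemma fact_pideal p k : prime p -> (0 < k)%N -> p%:R ^+ k / k`!%:R \in pideal p 1.
Proof.
move=> pp k0; have p0 := prime_gt0 pp.
have -> : p%:R ^+ k / k`!%:R = p%:R * (p%:R ^+ k.-1 / k`!%:R) :> rat.
  by rewrite mulrA -exprS prednK.
apply: pideal1M => //; elim/ltn_ind: k k0 => k IHk k0.
set u := (k %/ p)%N; set v := (k %% p)%N.
have vp : (v < p)%N by rewrite ltn_pmod.
have kE : k = (v + u * p)%N by rewrite addnC -divn_eq.
rewrite -[in k`!]/k -pochhammer1 {2}kE (pochhammer_dwork_step u (dwork_step1 p0) (ltnW vp)).
have -> : dwork_extra p p.-1 1 v u = 1.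
  by rewrite /dwork_extra ltnNge -ltnS prednK // vp.
have pn0 : p%:R != 0 :> rat by rewrite pnatr_eq0 -lt0n.
have [u0|u0] := posnP u.
  rewrite u0 expr0 /pochhammer big_ord0 !mul1r rpredM ?rpredX ?rpred_nat //.
  exact: upochV_pint pp (dwork_step1 p0).
have ku : (u + u.-1 <= k.-1)%N.
  have := prime_gt1 pp; rewrite kE; nia.
have -> : p%:R ^+ k.-1 / (p%:R ^+ u * pochhammer 1 u * 1 * upoch p p.-1 1 (v + u * p)) =
  p%:R ^+ (k.-1 - (u + u.-1)) * (p%:R ^+ u.-1 / u`!%:R) /
   upoch p p.-1 1 (v + u * p) :> rat.
  rewrite -{1}(subnK ku) !exprD pochhammer1; field.
  by rewrite (upoch_neq0 _ (dwork_step1 p0)) fact_neq0 expf_neq0.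
rewrite rpredM ?(upochV_pint _ pp (dwork_step1 p0)) // rpredM ?rpredX ?rpred_nat //.
by apply: IHk => //; rewrite /u ltn_Pdiv ?prime_gt1.
Qed.

Lemma fidealX p k f : f \in fideal p 1 -> f ^+ k \in fideal p k.
Proof.
move=> fp; elim: k => [|k IHk]; last by rewrite exprS -[k.+1]add1n fidealM.
by apply/fidealP => n; rewrite expr0 fps1 pideal0 rpred_nat.
Qed.

Lemma fideal_term p k f n : prime p -> f \in fideal p 1 -> (0 < k)%N ->
  (k`!%:R)^-1 * (f ^+ k) n \in pideal p 1.
Proof.
move=> pp fp k0; have p0 := prime_gt0 pp.
have pn0 : p%:R ^+ k != 0 :> rat by rewrite expf_neq0 // pnatr_eq0 -lt0n.
have -> : (k`!%:R)^-1 * (f ^+ k) n = p%:R ^+ k / k`!%:R * ((f ^+ k) n / p%:R ^+ k).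
  by field; rewrite pn0 fact_neq0.
apply: pidealMl; first exact: fact_pideal.
by have /fidealP := fidealX k fp; apply.
Qed.

(** The terms U^k / k! with k >= 2 only see the coefficients of U below n, and
    p^k / k! is divisible by p. *)
Lemma fps_exp_pideal p (U : fps) n : prime p -> U 0%N = 0 -> (0 < n)%N ->
  (forall i, (i < n)%N -> U i \in pideal p 1) ->
  fps_exp U n - U n \in pideal p 1.
Proof.
move=> pp U0 n0 Up; rewrite (fps_expE U0 (leqnn n)) big_ord_recl expr0 fps1.
rewrite gtn_eqF // mulr0 add0r.
case: n n0 Up => // n _ Up; rewrite big_ord_recl /= expr1 factS fact0 invr1 mul1r.
rewrite addrC addKr; apply: rpred_sum => k _.
have -> : (U ^+ (bump 0 (bump 0 k))) n.+1 = ((ftrunc n.+1 U) ^+ (k.+2)) n.+1.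
  set t := ftrunc n.+1 U; rewrite /bump !add1n ![_ ^+ k.+2]exprS !fpsM.
  have t0 : t 0%N = 0 by rewrite /t /ftrunc U0.
  apply: eq_bigr => -[i lti] _ /=.
  have [->|i0] := posnP i; first by rewrite U0 t0 !mul0r.
  have [ltin|] := ltnP i n.+1; last first.
    rewrite leq_eqVlt ltnNge -ltnS lti orbF => /eqP <-.
    by rewrite subnn !fpsX0 U0 t0 expr0n !mulr0.
  rewrite {1}/t /ftrunc ltin; congr (_ * _); apply: fpsX_agree => j jn.
  by rewrite /t /ftrunc (leq_ltn_trans jn) // ltn_subrL i0.
rewrite /bump !add1n; apply: fideal_term => //; apply/fidealP => i.
by rewrite /ftrunc; case: ifP => [/Up //|_]; rewrite rpred0.
Qed.

Section DieudonneDwork.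
Variables (p : nat) (pp : prime p) (T : fps).
Hypothesis T0 : T 0%N = 0.

Let p0 : (0 < p)%N := prime_gt0 pp.
Let U : fps := stretch p T - T *+ p.
Let Q : fps := fps_exp T.
Let E : fps := fps_exp U.

Let U0 : U 0%N = 0.
Proof. by rewrite /U fpsB stretch0 fpsMn T0 mul0rn subr0. Qed.

Let QE : stretch p Q = Q ^+ p * E.
Proof.
rewrite /Q fps_exp_stretch // -fps_exp_mulrn // -fps_exp_add ?fpsMn ?T0 ?mul0rn //.
by rewrite addrC subrK.
Qed.

Let Q0 : Q 0%N = 1. Proof. exact: fps_exp0. Qed.
Let E0 : E 0%N = 1. Proof. exact: fps_exp0. Qed.

Let QE_coef n : stretch p Q n =
   (Q ^+ p) n + \sum_(i < n) (Q ^+ p) i * E (n - i)%N.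
Proof. by rewrite QE fpsM big_ord_recr /= subnn E0 mulr1 addrC. Qed.

(** Induction on the degree in Q(z^p) = Q(z)^p E(z), where E = exp(U) is 1
    modulo p: the coefficient Q_n enters the right-hand side as p Q_n, and the
    rest is a congruence of Frobenius type for the lower part of Q. *)
Lemma fint_exp_of_stretch : U \in fideal p 1 -> Q \in fint p.
Proof.
move=> /fidealP Up.
have Ep n : (0 < n)%N -> E n \in pideal p 1.
  move=> n0; rewrite -[E n](subrK (U n)) rpredD //; exact: fps_exp_pideal.
apply/fintP; elim/ltn_ind => -[|n] IHn; first by rewrite Q0 rpred1.
set t := ftrunc n.+1 Q.
have tp : t \in fint p.
  by apply/fintP => i; rewrite /t /ftrunc; case: ifP => [/IHn //|_]; rewrite rpred0.
have Qt : (Q ^+ p) n.+1 - (t ^+ p) n.+1 = p%:R * Q n.+1.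
  rewrite -fpsB subrXX fpsM big_ord_recr /= big1 ?add0r => [|i _]; last first.
    by rewrite fpsB /t /ftrunc ltn_ord subrr mul0r.
  rewrite subnn fpsB {1}/t /ftrunc ltnn subr0 fps_sumE mulrC; congr (_ * _).
  rewrite (eq_bigr (fun=> 1)) ?sumr_const ?card_ord // => i _.
  by rewrite fpsM0 !fpsX0 /t /ftrunc Q0 !expr1n mulr1.
have stretchQ : stretch p Q n.+1 = stretch p t n.+1.
  rewrite /stretch; case: ifP => // pn.
  by rewrite /t /ftrunc ltn_Pdiv ?prime_gt1.
have h : p%:R * Q n.+1 \in pideal p 1.
  have := frobenius_fint pp tp => /fidealP/(_ n.+1); rewrite fpsB -stretchQ QE_coef.
  set S := \sum_(i < _) _ => h.
  have Sp : S \in pideal p 1.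
    apply: rpred_sum => i _; apply: pidealMr; last by rewrite Ep // subn_gt0.
    rewrite (@fpsX_agree i p Q t) => [|j ji]; first by move/fintP: (rpredX p tp).
    by rewrite /t /ftrunc (leq_ltn_trans ji).
  rewrite -Qt; have -> : (Q ^+ p) n.+1 - (t ^+ p) n.+1 =
     - ((t ^+ p) n.+1 - ((Q ^+ p) n.+1 + S)) - S by ring.
  by rewrite rpredB ?rpredN.
by move: h; rewrite pidealE expr1 mulrAC divff ?mul1r // pnatr_eq0 -lt0n.
Qed.

(** By the Frobenius congruence E = Q(z^p) / Q(z)^p is 1 modulo p, and then so
    is its logarithm U, degree by degree. *)
Lemma stretch_of_fint_exp : Q \in fint p -> U \in fideal p 1.
Proof.
move=> Qp; have Ep n : (0 < n)%N -> E n \in pideal p 1.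
  elim/ltn_ind: n => -[//|n] IHn _.
  have := frobenius_fint pp Qp => /fidealP/(_ n.+1); rewrite fpsB QE_coef.
  rewrite big_ord_recl subn0 fpsX0 Q0 expr1n mul1r.
  set S := \sum_(i < _) _ => h.
  have Sp : S \in pideal p 1.
    apply: rpred_sum => i _; apply: pidealMr; first by move/fintP: (rpredX p Qp).
    by apply: IHn; rewrite lift0 subSS ?ltnS ?leq_subr // subn_gt0.
  have -> : E n.+1 = - ((Q ^+ p) n.+1 - ((Q ^+ p) n.+1 + (E n.+1 + S))) - S by ring.
  by rewrite rpredB ?rpredN.
apply/fidealP; elim/ltn_ind => -[|n] IHn; first by rewrite U0 rpred0.
have -> : U n.+1 = E n.+1 - (E n.+1 - U n.+1) by ring.
by rewrite rpredB ?Ep // fps_exp_pideal.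
Qed.

End DieudonneDwork.

(** * Hypergeometric series and Dwork's congruence *)

Definition hF (I : Type) (s : seq I) (x : I -> rat) : fps := hcoef s x.
Definition hG (I : Type) (s : seq I) (x : I -> rat) : fps :=
  fun k => hcoef s x k * hharm s x k.
Definition hT (I : Type) (s : seq I) (x : I -> rat) : fps :=
  fps_div (hG s x) (hF s x).

Section HypergeometricSeries.
Variables (I : Type) (s : seq I) (x : I -> rat).

Lemma hF0 : hF s x 0%N = 1.
Proof. by rewrite /hF /hcoef big1 // => e _; rewrite pbin0. Qed.

Lemma hharm0 : hharm s x 0%N = 0.
Proof. by rewrite /hharm big1 // => e _; rewrite /harm big_ord0. Qed.

Lemma hT_mul : hT s x * hF s x = hG s x.
Proof.
have Fn0 : hF s x 0%N != 0 by rewrite hF0 oner_neq0.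
have FV : (hF s x * fps_inv (hF s x) : fps) = 1.
  by apply/funext => n; rewrite -[RHS](fps_mulV Fn0).
have -> : hT s x = hG s x * (fps_inv (hF s x) : fps) by [].
by rewrite -mulrA [fps_inv _ * _]mulrC FV mulr1.
Qed.

Lemma hT0 : hT s x 0%N = 0.
Proof.
have /(congr1 (fun f : fps => f 0%N)) := hT_mul.
by rewrite fpsM0 hF0 mulr1 => ->; rewrite /hG hharm0 mulr0.
Qed.

End HypergeometricSeries.

(** A series with constant term 1 is invertible, and the inverse preserves
    integrality degree by degree. *)
Lemma fideal_cancel p (V Z : fps) n : V 0%N = 1 -> V \in fint p ->
  (forall i, (i <= n)%N -> (V * Z) i \in pideal p 1) ->
  forall i, (i <= n)%N -> Z i \in pideal p 1.
Proof.
move=> V0 /fintP Vp VZ; elim/ltn_ind=> i IHi le_in.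
have := VZ i le_in; rewrite fpsM big_ord_recl V0 mul1r subn0 => h.
rewrite rpredDr // in h; apply: rpred_sum => j _; apply: pidealMr => //.
apply: IHi; last exact: leq_trans (leq_subr _ _) le_in.
by rewrite ltn_subrL lift0 /= (leq_ltn_trans _ (ltn_ord j)).
Qed.

Lemma dwork_sumE p (A h : nat -> rat) e K f : (K < p ^ e)%N ->
  dwork_sum p A h e K f =
  \sum_(j < K.+1) A j * A (K - j)%N * h j * (f j (K - j)%N - f (K - j)%N j).
Proof.
move=> Ke; rewrite /dwork_sum.
rewrite (big_ord_widen _ (fun j => A j * A (K - j)%N * h j *
   (f j (K - j)%N - f (K - j)%N j)) Ke) [RHS]big_mkcond.
apply: eq_bigr => j _ /=; rewrite ltnS; case: leqP => jK; last first.
  rewrite big1 // => l _; case: eqP => // jl.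
  by rewrite -jl ltnNge leq_addr in jK.
have lt : (K - j < p ^ e)%N := leq_ltn_trans (leq_subr _ _) Ke.
rewrite (bigD1 (Ordinal lt)) //= subnKC // eqxx big1 ?addr0 // => l.
rewrite -val_eqE /=; case: (j + l =P K)%N => // <-.
by rewrite addKn eqxx.
Qed.

Section DworkRelation.
Variables (p : nat) (pp : prime p) (I : eqType) (s : seq I).
Variables (x x' : I -> rat) (r : I -> nat).
Hypothesis xs : {in s, forall e, dwork_step p (x e) (x' e) (r e)}.

Let A := hcoef s x'.
Let h := hharm s x'.
Let R := hratio p s x x' r.

(** Dwork's congruence with the denominators cleared: its vanishing modulo p
    is equivalent to p T_x(z) = T_x'(z^p). *)
Definition dwork_defect : fps :=
  stretch p (hF s x') * (hG s x *+ p) - stretch p (hG s x') * hF s x.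

(** Replacing p h(v + j p) by h'(j) costs a multiple of p; exchanging the two
    indices in the second product antisymmetrises the sum. *)
Lemma dwork_defect_coef v K : (v < p)%N ->
  dwork_defect (v + K * p)%N - \sum_(j < K.+1) A j * A (K - j)%N * h j *
     (R v j - R v (K - j)%N) \in pideal p 1.
Proof.
move=> vp; rewrite /dwork_defect fpsB !stretch_mulE //.
under [X in _ - X]eq_bigr do rewrite mulrBr; rewrite sumrB.
rewrite (reindex_inj rev_ord_inj) /= [X in _ - X - _](reindex_inj rev_ord_inj) /=.
rewrite [X in _ - (_ - X)](reindex_inj rev_ord_inj) /= -!sumrB.
apply: rpred_sum => -[j lt] _ /=; have le_jK : (j <= K)%N by rewrite -ltnS.
rewrite !subSS subKn // fpsMn /hG /hF.
set B := hcoef s x _; set H := hharm s x _.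
set l := (K - j)%N.
have -> : hcoef s x' l * (B * H *+ p) - hcoef s x' l * hharm s x' l * B -
   (A j * A l * h j * R v j - A l * A j * h l * R v j) =
   A l * (B * (p%:R * H - h j)).
  rewrite /B (hcoef_dwork_step xs j vp) -/A -/h -/R -mulr_natl; ring.
apply: pidealMr; first exact: (hcoef_pint' pp xs).
exact: (hharm_dwork_step pp xs j vp).
Qed.

(** When the step permutes the parameters, A and h are their own primed
    versions and the general induction applies in all degrees. *)
Lemma dwork_defect_self : hcoef s x =1 hcoef s x' -> hharm s x =1 hharm s x' ->
  dwork_defect \in fideal p 1.
Proof.
move=> Ax hx; have p1 := prime_gt1 pp; apply/fidealP => n.
rewrite (divn_eq n p) addnC; set v := (n %% p)%N; set K := (n %/ p)%N.
have vp : (v < p)%N by rewrite ltn_pmod // prime_gt0.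
apply: pideal_of_diff (dwork_defect_coef K vp) _.
have Ke : (K < p ^ K)%N by rewrite ltn_expl.
have <- := dwork_sumE A h (fun i _ => R v i) Ke.
apply: (@dwork_sum_pideal p pp A h R).
- by move=> k; exact: (hcoef_pint' pp xs).
- by move=> w u wp; rewrite /A -Ax (hcoef_dwork_step xs).
- exact: hratio_lip.
- by move=> w u wp; rewrite /A /h -Ax -(hx (w + u * p)%N); exact: (hharm_dwork_step pp xs).
- by apply: lip_lip2l; apply: hratio_lip.
Qed.

(** As long as the harmonic sums have no denominators, the sum vanishes modulo
    p because the ratio is constant modulo p. *)
Lemma dwork_defect_low n : (forall j, (j <= n %/ p)%N -> hharm s x' j \in pint p) ->
  dwork_defect n \in pideal p 1.
Proof.
move=> hp; rewrite (divn_eq n p) addnC.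
set v := (n %% p)%N; set K := (n %/ p)%N in hp *.
have vp : (v < p)%N by rewrite ltn_pmod // prime_gt0.
apply: pideal_of_diff (dwork_defect_coef K vp) _; apply: rpred_sum => j _.
apply: pidealMr.
  have Ap k : A k \in pint p by exact: (hcoef_pint' pp xs).
  by rewrite rpredM ?hp -1?ltnS // rpredM.
have [_ Rl] := hratio_lip pp xs v.
by apply: (Rl 0%N); rewrite !modn1.
Qed.

Lemma dwork_congruence n : (forall i, (i <= n)%N -> dwork_defect i \in pideal p 1) ->
  forall i, (i <= n)%N -> (hT s x *+ p - stretch p (hT s x')) i \in pideal p 1.
Proof.
move=> hn; have p0 := prime_gt0 pp.
apply: (@fideal_cancel p (stretch p (hF s x') * hF s x)).
- by rewrite fpsM0 stretch0 !hF0 mulr1.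
- apply: rpredM; apply/fintP => i; last exact: (hcoef_pint pp xs).
  by rewrite /stretch; case: ifP; rewrite ?rpred0 //= => _; apply: (hcoef_pint' pp xs).
move=> i le_in; suff -> : stretch p (hF s x') * hF s x *
    (hT s x *+ p - stretch p (hT s x')) = dwork_defect by apply: hn.
rewrite /dwork_defect -(hT_mul s x) -(hT_mul s x') stretchM //.
rewrite -[hT s x *+ p]mulr_natl -[(hT s x * _) *+ p]mulr_natl.
ring.
Qed.

End DworkRelation.

(** * Growth of denominators at a fixed prime *)

Lemma fps_rescaleM c f g : fps_rescale c (f * g) = fps_rescale c f * fps_rescale c g.
Proof.
apply/funext => n; rewrite fpsM /fps_rescale fpsM mulr_sumr.
apply: eq_bigr => i _; have le_in : (i <= n)%N by rewrite -ltnS.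
by rewrite -{1}(subnKC le_in) exprD mulrACA.
Qed.

Lemma fps_rescaleX c f k : fps_rescale c (f ^+ k) = fps_rescale c f ^+ k.
Proof.
elim: k => [|k IHk]; last by rewrite !exprS fps_rescaleM IHk.
by rewrite !expr0; apply/funext => -[|n]; rewrite /fps_rescale ?mulr1 ?mulr0.
Qed.

Lemma fps_rescale0 c (f : fps) : fps_rescale c f 0%N = f 0%N.
Proof. by rewrite /fps_rescale mul1r. Qed.

Lemma fps_rescale_exp c (f : fps) : f 0%N = 0 ->
  fps_rescale c (fps_exp f) = fps_exp (fps_rescale c f).
Proof.
move=> f0; apply/funext => n; rewrite (fps_expE _ (leqnn n)) ?fps_rescale0 //.
rewrite /fps_rescale (fps_expE f0 (leqnn n)) mulr_sumr.
apply: eq_bigr => k _; rewrite mulrCA; congr (_ * _).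
by rewrite -[RHS]/((fps_rescale c f ^+ k) n) -fps_rescaleX.
Qed.

Lemma fint_exp_fideal p (U : fps) : prime p -> U 0%N = 0 -> U \in fideal p 1 ->
  fps_exp U \in fint p.
Proof.
move=> pp U0 Up; apply/fintP => n; rewrite (fps_expE U0 (leqnn n)).
apply: rpred_sum => -[[|k] ltk] _ /=.
  by rewrite expr0 fps1 fact0 invr1 mul1r rpred_nat.
by apply: (@pideal_pint p 1); rewrite ?prime_gt0 // fideal_term.
Qed.

Lemma exp_nat_pint p n k : prime p -> (0 < n <= k)%N -> p%:R ^+ k / n%:R \in pint p.
Proof.
move=> pp /andP[n0 nk]; have p0 := prime_gt0 pp.
have [m [m0 mp nE]] : exists m, [/\ (0 < m)%N, coprime p m & n = (p ^ logn p n * m)%N].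
  by have [m pm nE] := pfactor_coprime pp n0; exists m; split=> //;
     [move: n0; rewrite nE; case: (m) | rewrite mulnC].
have le : (logn p n <= k)%N.
  by apply: leq_trans nk; apply: ltnW; apply: ltn_logl.
have -> : p%:R ^+ k / n%:R = p%:R ^+ (k - logn p n) * m%:R^-1 :> rat.
  rewrite {1}nE -{1}(subnK le) exprD natrM natrX; field.
  by rewrite !pnatr_eq0 -!lt0n m0 expf_neq0 // pnatr_eq0 -lt0n.
by rewrite rpredM ?rpredX ?rpred_nat // pintV_nat.
Qed.

Definition frac (d x : nat) : rat := x%:R / d%:R.

Section SmallPrimes.
Variables (p : nat) (pp : prime p) (d : nat) (s : seq nat).
Hypothesis s_lt : {in s, forall x, (0 < x < d)%N}.

Lemma pbin_frac_growth x k : (0 < d)%N ->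
  p%:R ^+ (d.+1 * k) * pbin (frac d x) k \in pint p.
Proof.
move=> d0; have dn0 : d%:R != 0 :> rat by rewrite pnatr_eq0 -lt0n.
have -> : p%:R ^+ (d.+1 * k) * pbin (frac d x) k =
   (p%:R ^+ d / d%:R) ^+ k * (p%:R ^+ k / k`!%:R) * (\prod_(i < k) (x + d * i)%:R).
  have -> : pbin (frac d x) k = (\prod_(i < k) (x + d * i)%:R) / d%:R ^+ k / k`!%:R.
    rewrite /pbin /pochhammer; congr (_ / _).
    rewrite -[X in _ / _ ^+ X]card_ord -prodr_const -prodf_div.
    by apply: eq_bigr => i _; rewrite /frac natrD natrM; field.
  rewrite mulSn exprD exprM expr_div_n; field.
  by rewrite fact_neq0 expf_neq0.
rewrite rpredM ?rpred_prod // => [|i _]; last by rewrite rpred_nat.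
apply: rpredM; first by rewrite rpredX // exp_nat_pint ?d0 ?leqnn.
case: k => [|k]; first by rewrite expr0 divr1 rpred1.
by apply: (@pideal_pint p 1); rewrite ?prime_gt0 // fact_pideal.
Qed.

Lemma harm_frac_growth x k : (0 < x < d)%N ->
  p%:R ^+ (d * k) * harm (frac d x) k \in pint p.
Proof.
move=> /andP[x0 xd]; have d0 : (0 < d)%N := ltn_trans x0 xd.
have dn0 : d%:R != 0 :> rat by rewrite pnatr_eq0 -lt0n.
rewrite mulr_sumr; apply: rpred_sum => -[i ik] _ /=; rewrite mulrBr rpredB //.
  have -> : (frac d x + i%:R)^-1 = d%:R / (x + d * i)%:R :> rat.
    have xdi : (x + d * i)%:R != 0 :> rat by rewrite pnatr_eq0 -lt0n addn_gt0 x0.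
    apply: (canRL (mulfK xdi)).
    have e : frac d x + i%:R = (x + d * i)%:R / d%:R.
      by rewrite /frac natrD natrM; field.
    by rewrite e invf_div divfK.
  rewrite mulrCA rpredM ?rpred_nat // exp_nat_pint // addn_gt0 x0 /=.
  nia.
rewrite nat1r exp_nat_pint //=; nia.
Qed.

(** For a large power c of p, F(c z) is integral and G(c z) is divisible by p;
    hence T(c z) is divisible by p, and its exponential is integral. *)
Lemma hT_growth : (0 < d)%N -> exists e, forall n,
  p%:R ^+ (e * n) * fps_exp (hT s (frac d)) n \in pint p.
Proof.
move=> d0; set e1 := (size s * d.+1)%N.
have Fp k : p%:R ^+ (e1 * k) * hcoef s (frac d) k \in pint p.
  rewrite /e1 /hcoef; elim: s => [|x t IHt].
    by rewrite big_nil mulr1 rpredX ?rpred_nat.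
  rewrite big_cons /= mulSn mulnDl exprD mulrACA rpredM //.
  exact: pbin_frac_growth d0.
have hp k : p%:R ^+ (d * k) * hharm s (frac d) k \in pint p.
  rewrite mulr_sumr big_seq rpred_sum // => x /s_lt; exact: harm_frac_growth.
pose c : rat := p%:R ^+ (e1 + d).+1.
have cE k : c ^+ k = p%:R ^+ (e1 * k) * p%:R ^+ (d * k) * p%:R ^+ k.
  by rewrite /c -exprM -!exprD mulSn mulnDl addnC.
have Fs : fps_rescale c (hF s (frac d)) \in fint p.
  apply/fintP => k; rewrite /fps_rescale cE /hF.
  set a := p%:R ^+ (e1 * k); set b := p%:R ^+ _; set f := p%:R ^+ k.
  have -> : a * b * f * hcoef s (frac d) k = (b * f) * (a * hcoef s (frac d) k) by ring.
  by rewrite rpredM ?Fp // rpredM // rpredX ?rpred_nat.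
have Gs k : fps_rescale c (hG s (frac d)) k \in pideal p 1.
  have [->|k0] := posnP k; first by rewrite fps_rescale0 /hG hharm0 mulr0 rpred0.
  rewrite /fps_rescale cE /hG.
  set a := p%:R ^+ (e1 * k); set b := p%:R ^+ _; set f := p%:R ^+ k.
  have -> : a * b * f * (hcoef s (frac d) k * hharm s (frac d) k) =
     f * ((a * hcoef s (frac d) k) * (b * hharm s (frac d) k)) by ring.
  apply: pidealMl; last by apply: rpredM; [exact: Fp|exact: hp].
  have p0 := prime_gt0 pp; apply: (@pideal_le p 1 k) => //; exact: pideal_exp.
have Ts : fps_rescale c (hT s (frac d)) \in fideal p 1.
  apply/fidealP => n; apply: (@fideal_cancel p (fps_rescale c (hF s (frac d))) _ n) => //.
    by rewrite fps_rescale0 hF0.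
  by move=> i _; rewrite mulrC -fps_rescaleM hT_mul.
exists (e1 + d).+1 => n; rewrite exprM -/c.
have T0 := hT0 s (frac d).
suff /fintP/(_ n) : fps_rescale c (fps_exp (hT s (frac d))) \in fint p by [].
by rewrite fps_rescale_exp // fint_exp_fideal ?fps_rescale0.
Qed.

End SmallPrimes.

(** * Parameters with a common denominator *)

(** Action of an integer c on fractions x/d with denominator d, on
    numerators. *)
Definition conjugate (d c : nat) (s : seq nat) : seq nat :=
  [seq (c * x %% d)%N | x <- s].

Definition numerators (d : nat) (s : seq nat) : Prop :=
  {in s, forall x, (0 < x < d)%N}.

(** The logarithm of q(z)/z for the parameters x/d. *)
Definition log_mirror (d : nat) (s : seq nat) : fps := hT s (frac d).

Lemma hT_ext (I J : Type) (s : seq I) (t : seq J) x y :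
  hcoef s x =1 hcoef t y -> hharm s x =1 hharm t y -> hT s x = hT t y.
Proof.
move=> /funext cE /funext hE; rewrite /hT /hF /hG cE.
by congr (fps_div _ _); apply/funext => k; rewrite hE.
Qed.

Lemma hcoef_map (I J : Type) (f : I -> J) (s : seq I) x k :
  hcoef (map f s) x k = hcoef s (x \o f) k.
Proof. by rewrite /hcoef big_map. Qed.

Lemma hharm_map (I J : Type) (f : I -> J) (s : seq I) x k :
  hharm (map f s) x k = hharm s (x \o f) k.
Proof. by rewrite /hharm big_map. Qed.

Lemma hcoef_perm (I : eqType) (s t : seq I) x k :
  perm_eq s t -> hcoef s x k = hcoef t x k.
Proof. by move=> st; apply: perm_big. Qed.

Lemma hharm_perm (I : eqType) (s t : seq I) x k :
  perm_eq s t -> hharm s x k = hharm t x k.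
Proof. by move=> st; apply: perm_big. Qed.

Lemma log_mirror_perm d s t : perm_eq s t -> log_mirror d s = log_mirror d t.
Proof. by move=> st; apply: hT_ext => k; [apply: hcoef_perm|apply: hharm_perm]. Qed.

Lemma log_mirror_conjugate d c s :
  log_mirror d (conjugate d c s) = hT s (fun x => frac d (c * x %% d)).
Proof. by apply: hT_ext => k; [apply: hcoef_map|apply: hharm_map]. Qed.

Lemma conjugate_conjugate d b c s :
  conjugate d b (conjugate d c s) = conjugate d (b * c) s.
Proof.
by rewrite /conjugate -map_comp; apply: eq_map => x /=; rewrite modnMmr mulnA.
Qed.

Lemma conjugate_mod d c s : conjugate d (c %% d) s = conjugate d c s.
Proof. by apply: eq_map => x; rewrite modnMml. Qed.

Lemma conjugate1 d c s : numerators d s -> c = 1 %[mod d] -> conjugate d c s = s.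
Proof.
move=> sd c1; rewrite -[RHS]map_id; apply/eq_in_map => x /sd /andP[_ xd].
by rewrite -modnMml c1 modnMml mul1n modn_small.
Qed.

Lemma conjugate_bound d c x : coprime c d -> (0 < x < d)%N -> (0 < c * x %% d < d)%N.
Proof.
move=> cd /andP[x0 xd]; rewrite ltn_mod (leq_ltn_trans _ xd) // andbT lt0n.
rewrite -/(dvdn d (c * x)) Gauss_dvdr 1?coprime_sym //.
by apply/negP => /(dvdn_leq x0); rewrite leqNgt xd.
Qed.

Lemma conjugate_numerators d c s : coprime c d -> numerators d s ->
  numerators d (conjugate d c s).
Proof. by move=> cd sd y /mapP[x /sd xd ->]; apply: conjugate_bound. Qed.

(** Dwork's map divides by p modulo d: it sends the fraction with numerator p
    y mod d to y/d. *)
Lemma dwork_step_frac p d y : prime p -> coprime p d -> (0 < y < d)%N ->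
  dwork_step p (frac d (p * y %% d)) (frac d y) (p * y %/ d).
Proof.
move=> pp pd yd; have /andP[z0 _] := conjugate_bound pd yd.
case/andP: yd => y0 yd; have d0 := ltn_trans y0 yd; have p0 := prime_gt0 pp.
have dn0 : d%:R != 0 :> rat by rewrite pnatr_eq0 -lt0n.
split.
- by rewrite ltn_divLR // ltn_pmul2l.
- rewrite /frac mulrA -natrM {3}(divn_eq (p * y) d) natrD natrM; field.
  exact: dn0.
- by apply: rpredM; [apply: rpred_nat|apply: pintV_nat].
- by rewrite /frac divr_gt0 // ltr0n.
- by rewrite /frac divr_gt0 // ltr0n.
Qed.

Section LargePrimes.
Variables (p d : nat) (s : seq nat).
Hypotheses (pp : prime p) (pd : coprime p d) (sd : numerators d s).

Let steps : {in s, forall y, dwork_step p (frac d (p * y %% d)) (frac d y) (p * y %/ d)}.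
Proof. by move=> y /sd; apply: dwork_step_frac. Qed.

Lemma log_mirror_fint :
  perm_eq (conjugate d p s) s -> fps_exp (log_mirror d s) \in fint p.
Proof.
move=> st; apply: fint_exp_of_stretch => //; first exact: hT0.
have cE : hcoef s (fun y => frac d (p * y %% d)) =1 hcoef s (frac d).
  by move=> k; rewrite -[RHS](hcoef_perm _ _ st) hcoef_map.
have hE : hharm s (fun y => frac d (p * y %% d)) =1 hharm s (frac d).
  by move=> k; rewrite -[RHS](hharm_perm _ _ st) hharm_map.
have /fidealP Dp := dwork_defect_self pp steps cE hE.
apply/fidealP => n; rewrite -opprB fpsN rpredN.
have := @dwork_congruence _ pp _ _ _ _ _ steps n (fun i _ => Dp i) n (leqnn n).
by rewrite (hT_ext cE hE).
Qed.

(** Modulo p, integrality gives T(z^p) = p T(z) and Dwork's congruence gives p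
    T(z) = T'(z^p), T being the series of the conjugate and T' that of s;
    compare the coefficients of z^(n p). As d n < p, the harmonic sums up to n
    have no denominator divisible by p. *)
Lemma log_mirror_congr n :
  fps_exp (log_mirror d (conjugate d p s)) \in fint p -> (d * n < p)%N ->
  log_mirror d (conjugate d p s) n - log_mirror d s n \in pideal p 1.
Proof.
move=> Qp np; have p0 := prime_gt0 pp.
have /fidealP/(_ (n * p)%N) := stretch_of_fint_exp pp (hT0 _ _) Qp.
have hp j : (j <= n)%N -> hharm s (frac d) j \in pint p.
  move=> jn; rewrite /hharm big_seq rpred_sum // => y /sd /andP[y0 yd].
  have d0 := ltn_trans y0 yd.
  have dn0 : d%:R != 0 :> rat by rewrite pnatr_eq0 -lt0n.
  apply: rpred_sum => -[i ij] _ /=; apply: rpredB; last first.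
    rewrite nat1r pintV_nat // prime_coprime // gtnNdvd //; nia.
  have -> : frac d y + i%:R = (y + d * i)%:R / d%:R.
    by rewrite /frac natrD natrM; field.
  rewrite invf_div rpredM ?rpred_nat // pintV_nat // prime_coprime // gtnNdvd //.
    by rewrite addn_gt0 y0.
  nia.
have Dp i : (i <= n * p)%N -> dwork_defect p s (fun y => frac d (p * y %% d)) (frac d) i
     \in pideal p 1.
  move=> ile; apply: (dwork_defect_low pp steps) => j jle; apply: hp.
  by apply: leq_trans jle _; rewrite -(mulnK n p0) leq_div2r.
have h2 := dwork_congruence pp steps Dp (leqnn (n * p)); move=> h1.
have subE f : stretch p f (n * p)%N = f n by rewrite /stretch dvdn_mull // mulnK.
rewrite -log_mirror_conjugate fpsB subE in h2; rewrite fpsB subE in h1.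
have -> : log_mirror d (conjugate d p s) n - log_mirror d s n =
  (log_mirror d (conjugate d p s) n - (log_mirror d (conjugate d p s) *+ p) (n * p)%N) +
  ((log_mirror d (conjugate d p s) *+ p) (n * p)%N - log_mirror d s n) by ring.
exact: rpredD.
Qed.

End LargePrimes.

Lemma F_hF (a : 4.-tuple rat) d s : perm_eq a (map (frac d) s) ->
  F a = hF s (frac d).
Proof.
move=> as_; apply/funext => k; rewrite /hF -[RHS](hcoef_map (frac d) s id).
rewrite -(hcoef_perm _ _ as_) /hcoef big_tuple /F.
by rewrite -[X in _ / _ ^+ X](card_ord 4) -prodr_const -prodf_div.
Qed.

Lemma G_hG (a : 4.-tuple rat) d s : perm_eq a (map (frac d) s) ->
  G a = hG s (frac d).
Proof.
move=> as_; apply/funext => k; rewrite /hG -[hcoef _ _]/(hF s (frac d)) -(F_hF as_).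
congr (_ * _); rewrite -[RHS](hharm_map (frac d) s id).
by rewrite -(hharm_perm _ _ as_) /hharm big_tuple.
Qed.

Lemma mirror_mapE (a : 4.-tuple rat) d s n : perm_eq a (map (frac d) s) ->
  mirror_map a n = if n is m.+1 then fps_exp (log_mirror d s) m else 0.
Proof.
move=> as_; rewrite /mirror_map (F_hF as_) (G_hG as_) -/(hT _ _) -/(log_mirror d s).
rewrite -[fps_mul _ _ _]/((fps_var * fps_exp (log_mirror d s) : fps) n) fpsM /fps_var.
case: n => [|n]; first by rewrite big_ord1 mul0r.
rewrite big_ord_recl mul0r add0r big_ord_recl mul1r subSS subn0 big1 ?addr0 //.
by move=> i _; rewrite mul0r.
Qed.

Definition almost_integral (T : fps) : Prop :=
  exists B, forall p, prime p -> (B < p)%N -> fps_exp T \in fint p.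

(** Primes larger than N do not divide N. *)
Lemma N_integral_almost (a : 4.-tuple rat) d s : perm_eq a (map (frac d) s) ->
  N_integral (mirror_map a) -> almost_integral (log_mirror d s).
Proof.
move=> as_ [N N1 Ni]; exists N => p pp Np; apply/fintP => n.
have := Ni n.+1; rewrite /fps_rescale (mirror_mapE _ as_) => /(int_pint p).
set q := fps_exp _ n => h.
have NV : (N%:R : rat)^-1 \in pint p.
  by rewrite pintV_nat // prime_coprime // gtnNdvd.
have -> : q = (N%:R)^-1 ^+ n.+1 * (N%:R ^+ n.+1 * q).
  by rewrite mulrA -exprMn mulVf ?expr1n ?mul1r // pnatr_eq0 -lt0n.
by rewrite rpredM // rpredX.
Qed.

(** At each of the finitely many remaining primes the denominators grow at
    most geometrically, so a product of powers of these primes serves as N. *)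
Lemma almost_N_integral (a : 4.-tuple rat) d s : perm_eq a (map (frac d) s) ->
  (0 < d)%N -> numerators d s -> almost_integral (log_mirror d s) ->
  N_integral (mirror_map a).
Proof.
move=> as_ d0 sd [B Bi].
have [N N1 Np] : exists2 N : nat, (0 < N)%N & forall p, prime p -> (p <= B)%N ->
    forall n, N%:R ^+ n * fps_exp (log_mirror d s) n \in pint p.
  elim: B {Bi} => [|B [N N1 Np]].
    by exists 1%N => // p pp; rewrite leqn0 => /eqP pE; rewrite pE in pp.
  have [Bp|Bp] := boolP (prime B.+1); last first.
    exists N => // p pp; rewrite leq_eqVlt => /orP[/eqP pE|]; last exact: Np.
    by rewrite -pE pp in Bp.
  have [e He] := hT_growth Bp sd d0.
  exists (B.+1 ^ e * N)%N; first by rewrite muln_gt0 expn_gt0.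
  move=> p pp; rewrite leq_eqVlt => /orP[/eqP pE|pB] n.
    rewrite natrM exprMn natrX -exprM mulrAC pE.
    by apply: rpredM; [exact: He | rewrite rpredX ?rpred_nat].
  rewrite natrM exprMn -mulrA; apply: rpredM; last exact: Np.
  by rewrite rpredX ?rpred_nat.
exists N => // -[|n]; first by rewrite /fps_rescale (mirror_mapE _ as_) mulr0 rpred0.
rewrite /fps_rescale (mirror_mapE _ as_); apply: int_of_pint => p pp.
rewrite exprS -mulrA rpredM ?rpred_nat //.
have [pB|Bp] := leqP p B; first exact: Np.
by rewrite rpredM ?rpredX ?rpred_nat //; move/fintP: (Bi _ pp Bp).
Qed.

(** * Reduction modulo a large prime and degrees *)

(** The units of Z_(p). *)
Definition punit (p : nat) : {pred rat} :=
  [pred x | [&& x != 0, x \in pint p & x^-1 \in pint p]].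

Lemma punitM p x y : x \in punit p -> y \in punit p -> x * y \in punit p.
Proof.
case/and3P=> x0 xp xV /and3P[y0 yp yV].
by apply/and3P; rewrite mulf_neq0 // invfM !rpredM.
Qed.

Lemma punit_prod p (I : eqType) (s : seq I) (f : I -> rat) :
  {in s, forall e, f e \in punit p} -> \prod_(e <- s) f e \in punit p.
Proof.
move=> fp; rewrite big_seq; elim/big_rec: _ => [|e x es xp].
  by apply/and3P; rewrite oner_neq0 invr1 rpred1.
by apply: punitM => //; apply: fp.
Qed.

Lemma punit_notin_pideal p x : prime p -> x \in punit p -> x \notin pideal p 1.
Proof.
move=> pp /and3P[x0 xp xV]; apply/negP => /(pidealMr xV); rewrite mulVf //.
by rewrite -[1]/(1%:R) pideal_nat ?prime_gt0 // expn1 Euclid_dvd1.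
Qed.

(** For k < p only the first block of indices matters, so the coefficient at k
    is a unit for k <= r, and for k > r it contains exactly the factor p x',
    which is also the only non-integral denominator of the harmonic sum. *)
Section OneParameter.
Variables (p : nat) (pp : prime p) (x x' : rat) (r : nat).
Hypothesis xs : dwork_step p x x' r.
Variables (k : nat) (kp : (k < p)%N).

Let p0 : (0 < p)%N := prime_gt0 pp.

Let u : rat := upoch p r x k / upoch p p.-1 1 k.

Let u_unit : u \in punit p.
Proof.
apply/and3P; split.
- by rewrite mulf_neq0 ?invr_eq0 ?(upoch_neq0 _ xs) ?(upoch_neq0 _ (dwork_step1 p0)).
- by rewrite rpredM ?(upoch_pint _ xs) ?(upochV_pint _ pp (dwork_step1 p0)).
- by rewrite invf_div rpredM ?(upoch_pint _ (dwork_step1 p0)) ?(upochV_pint _ pp xs).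
Qed.

Let pbinE : pbin x k = (if (r < k)%N then p%:R * x' else 1) * u.
Proof.
have := pbin_dwork_step 0 xs kp.
by rewrite mul0n addn0 pbin0 mul1r /dwork_ratio /dwork_extra mul0n addn0 addr0.
Qed.

Let harmE : exists2 y, y \in pint p &
  harm x k = (if (r < k)%N then (p%:R * x')^-1 else 0) + y.
Proof.
have := harm_dwork_step 0 pp xs kp; rewrite mul0n addn0 {2}/harm big_ord0 add0r addr0.
rewrite pidealE expr1; set w := _ / _ => wp; exists w => //.
have pn0 : p%:R != 0 :> rat by rewrite pnatr_eq0 -lt0n.
have x0 : x' != 0 by case: xs => _ _ _ _ /lt0r_neq0.
by rewrite /w; case: ifP => _; field; rewrite ?pn0 ?x0.
Qed.

Lemma pbin_unit : (k <= r)%N -> pbin x k \in punit p.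
Proof. by move=> kr; rewrite pbinE ltnNge kr mul1r. Qed.

Lemma pbin_pideal : (r < k)%N -> pbin x k \in pideal p 1.
Proof.
move=> rk; rewrite pbinE rk; have /and3P[_ up _] := u_unit.
by case: xs => _ _ x'p _ _; rewrite -mulrA pideal1M // rpredM.
Qed.

Lemma harm_pint : (k <= r)%N -> harm x k \in pint p.
Proof.
by move=> kr; have [y yp ->] := harmE; rewrite ltnNge kr add0r.
Qed.

Lemma pbin_harm : (r < k)%N ->
  exists2 y, y \in punit p & pbin x k * harm x k - y \in pideal p 1.
Proof.
move=> rk; exists u => //; have [y yp yE] := harmE.
have x0 : x' != 0 by case: xs => _ _ _ _ /lt0r_neq0.
have pn0 : p%:R != 0 :> rat by rewrite pnatr_eq0 -lt0n.
have -> : pbin x k * harm x k - u = pbin x k * y.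
  by rewrite yE pbinE rk; field; rewrite x0 pn0.
by rewrite pidealMl // pbin_pideal.
Qed.

Lemma pbin_harm_pint : pbin x k * harm x k \in pint p.
Proof.
have [kr|rk] := leqP k r.
  by have /and3P[_ bp _] := pbin_unit kr; rewrite rpredM // harm_pint.
have [y /and3P[_ yp _] h] := pbin_harm rk.
by rewrite -(subrK y (_ * _)) rpredD // (pideal_pint p0 h).
Qed.

End OneParameter.

(** With r e1 <= r e2 the two smallest of the integers r e, the reductions of
    F and G modulo p and z^p have degrees r e1 and r e2: beyond r e1 the
    coefficient of F is divisible by p, while that of G loses one factor p
    against the harmonic sum and survives until a second factor p appears. *)
Section TruncationDegrees.
Variables (p : nat) (pp : prime p) (I : eqType) (s : seq I).
Variables (x x' : I -> rat) (r : I -> nat) (e1 e2 : I).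
Hypothesis xs : {in e1 :: e2 :: s, forall e, dwork_step p (x e) (x' e) (r e)}.
Hypothesis r12 : (r e1 <= r e2)%N.
Hypothesis r_min : {in s, forall e, (r e2 <= r e)%N}.
Let t := e1 :: e2 :: s.
Variables (k : nat) (kp : (k < p)%N).

Let p0 : (0 < p)%N := prime_gt0 pp.
Let xs1 : dwork_step p (x e1) (x' e1) (r e1). Proof. by apply: xs; rewrite mem_head. Qed.
Let xs2 : dwork_step p (x e2) (x' e2) (r e2).
Proof. by apply: xs; rewrite !inE eqxx orbT. Qed.
Let xss : {in s, forall e, dwork_step p (x e) (x' e) (r e)}.
Proof. by move=> e es; apply: xs; rewrite !inE es !orbT. Qed.

Let b_int e : e \in t -> pbin (x e) k \in pint p.
Proof.
move=> /xs es; apply: pbin_pint => //; first exact: dwork_step_pint es.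
by case: es.
Qed.

Lemma hF_pideal : (r e1 < k)%N -> hF t x k \in pideal p 1.
Proof.
move=> rk; rewrite /hF /hcoef /t big_cons; apply: pidealMl.
  exact: (pbin_pideal pp xs1 kp rk).
by rewrite big_seq rpred_prod // => e es; apply: b_int; rewrite inE es orbT.
Qed.

Lemma hF_unit : (k <= r e1)%N -> hF t x k \in punit p.
Proof.
move=> kr; apply: punit_prod => e et; apply: (pbin_unit pp (xs et) kp).
apply: leq_trans kr _; move: et; rewrite !inE => /or3P[/eqP->|/eqP->|/r_min h] //.
exact: leq_trans h.
Qed.

Lemma hG_pint : hG t x k \in pint p.
Proof.
rewrite /hG -pideal0; apply: prod_sum_pideal => e et; first exact: b_int.
by rewrite pideal0; apply: pbin_harm_pint (xs et) _ kp.
Qed.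

Lemma hG_pideal : (r e2 < k)%N -> hG t x k \in pideal p 1.
Proof.
move=> rk; rewrite /hG /hcoef /hharm /t !big_cons.
have b1 := pbin_pideal pp xs1 kp (leq_ltn_trans r12 rk).
have b2 := pbin_pideal pp xs2 kp rk.
have c1 := pbin_harm_pint pp xs1 kp; have c2 := pbin_harm_pint pp xs2 kp.
have P_int : \prod_(e <- s) pbin (x e) k \in pint p.
  by rewrite big_seq rpred_prod // => e es; apply: b_int; rewrite !inE es !orbT.
have PH : \prod_(e <- s) pbin (x e) k * \sum_(e <- s) harm (x e) k \in pint p.
  rewrite -pideal0; apply: prod_sum_pideal => e et.
    by apply: b_int; rewrite !inE et !orbT.
  by rewrite pideal0; apply: pbin_harm_pint (xss et) _ kp.
move: (pbin (x e1) k) (harm (x e1) k) (pbin (x e2) k) (harm (x e2) k) b1 b2 c1 c2.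
move: (\prod_(e <- s) _) (\sum_(e <- s) _) P_int PH.
move=> P H Pp PHp f1 h1 f2 h2 b1 b2 c1 c2.
have -> : f1 * (f2 * P) * (h1 + (h2 + H)) =
   f2 * (f1 * h1 * P) + f1 * (f2 * h2 * P) + f1 * (f2 * (P * H)) by ring.
apply: rpredD; first by apply: rpredD; rewrite pidealMl // rpredM.
by rewrite pidealMl // rpredM // (pideal_pint p0 b2).
Qed.

Lemma hG_unit : (r e1 < k)%N -> k = r e2 -> hG t x k \notin pideal p 1.
Proof.
move=> rk kE; have k2 : (k <= r e2)%N by rewrite kE.
rewrite /hG /hcoef /hharm /t !big_cons.
have b1 := pbin_pideal pp xs1 kp rk.
have b2 := pbin_unit pp xs2 kp k2.
have [u uu c1] := pbin_harm pp xs1 kp rk; have c2 := harm_pint pp xs2 kp k2.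
have P_unit : \prod_(e <- s) pbin (x e) k \in punit p.
  apply: punit_prod => e es; apply: (pbin_unit pp (xss es) kp).
  by rewrite kE r_min.
have Hp : \sum_(e <- s) harm (x e) k \in pint p.
  rewrite big_seq rpred_sum // => e es; apply: (harm_pint pp (xss es) kp).
  by rewrite kE r_min.
move: (pbin (x e1) k) (harm (x e1) k) (pbin (x e2) k) (harm (x e2) k) b1 b2 c1 c2.
move: (\prod_(e <- s) _) (\sum_(e <- s) _) P_unit Hp.
move=> P H Pu Hp f1 h1 f2 h2 b1 b2 c1 c2.
have fP := punitM b2 Pu; have /and3P[_ fPp _] := fP.
apply: contra (punit_notin_pideal pp (punitM uu fP)) => gI.
have -> : u * (f2 * P) = f1 * (f2 * P) * (h1 + (h2 + H)) -
   ((f1 * h1 - u) * (f2 * P) + f1 * ((f2 * P) * (h2 + H))) by ring.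
apply: rpredB => //; apply: rpredD; first exact: pidealMl.
by rewrite pidealMl // rpredM // rpredD.
Qed.

End TruncationDegrees.

(** Otherwise the coefficient of z^n in G_s F_t, with n the sum of the degrees
    of G_s and F_t modulo p, would be a unit, while n exceeds the degree of
    G_t F_s. The hypothesis x2 + y1 <= d ensures n < p, so that truncation at
    z^p loses nothing. *)
Lemma degree_gap p d x1 x2 s y1 y2 t :
  prime p -> (2 * d < p)%N -> numerators d [:: x1, x2 & s] ->
  numerators d [:: y1, y2 & t] ->
  (x1 <= x2)%N -> {in s, forall x, x2 <= x}%N ->
  (y1 <= y2)%N -> {in t, forall y, y2 <= y}%N ->
  log_mirror d (conjugate d p [:: x1, x2 & s]) =
    log_mirror d (conjugate d p [:: y1, y2 & t]) ->
  (x2 + y1 <= d)%N -> (x2 + y1 <= y2 + x1)%N.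
Proof.
move=> pp dp vs vt x12 xmin y12 ymin; rewrite !log_mirror_conjugate => TE le_d.
rewrite leqNgt; apply/negP => lt_gap.
set ss := [:: x1, x2 & s] in vs TE; set tt := [:: y1, y2 & t] in vt TE.
have x1d : (0 < x1 < d)%N by apply: vs; rewrite mem_head.
have d0 : (0 < d)%N by case/andP: x1d => h1 h2; apply: ltn_trans h2.
have pd : coprime p d by rewrite prime_coprime // gtnNdvd //; lia.
have p0 := prime_gt0 pp.
pose r e := (p * e %/ d)%N; pose x e := frac d (p * e %% d).
have mono e f : (e <= f)%N -> (r e <= r f)%N.
  by move=> ef; rewrite leq_div2r // leq_mul2l ef orbT.
have ds : {in ss, forall e, dwork_step p (x e) (frac d e) (r e)}.
  by move=> e /vs; apply: dwork_step_frac.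
have dt : {in tt, forall e, dwork_step p (x e) (frac d e) (r e)}.
  by move=> e /vt; apply: dwork_step_frac.
have rE e : (p * e = r e * d + p * e %% d)%N by apply: divn_eq.
have rd e : (p * e %% d < d)%N by rewrite ltn_mod.
have y1d : (0 < y1 < d)%N by apply: vt; rewrite mem_head.
have /andP[ry1 _] := conjugate_bound pd y1d.
have ltp : (r x2 + r y1 < p)%N.
  have := rE x2; have := rE y1; nia.
have r12 : (r x1 < r x2)%N.
  have := rE x2; have := rE x1; have := rd x2; nia.
have gap : (r y2 + r x1 < r x2 + r y1)%N.
  have := rE x2; have := rE x1; have := rE y1; have := rE y2.
  have := rd x2; have := rd y1; nia.
have rs : {in s, forall e, (r x2 <= r e)%N} by move=> e /xmin /mono.
have rt : {in t, forall e, (r y2 <= r e)%N} by move=> e /ymin /mono.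
have rx := ltnW r12; have ry := mono _ _ y12.
set n := (r x2 + r y1)%N in ltp gap.
have GF : hG ss x * hF tt x = hG tt x * hF ss x.
  by rewrite -!hT_mul TE; ring.
have := congr1 (fun f : fps => f n) GF; rewrite /= !fpsM.
have lt2n : (r x2 < n.+1)%N by rewrite ltnS leq_addr.
rewrite (bigD1 (Ordinal lt2n)) //= [(n - r x2)%N]addKn.
set a := hG ss x _; set b := hF tt x (r y1); set S := \sum_(i < _ | _) _.
set S' := \sum_(i < _) _ => abE.
have Fp q (q_lt : (q < p)%N) : hF tt x q \in pint p := hcoef_pint pp dt q.
have Fp' q (q_lt : (q < p)%N) : hF ss x q \in pint p := hcoef_pint pp ds q.
have Sp : S \in pideal p 1.
  apply: rpred_sum => -[i lti]; rewrite -val_eqE /= => ne.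
  have ip : (i < p)%N by apply: leq_ltn_trans ltp.
  have nip : (n - i < p)%N by apply: leq_ltn_trans ltp; apply: leq_subr.
  have [ltx|] := ltnP (r x2) i.
    by rewrite pidealMl ?Fp //; apply: (hG_pideal pp ds).
  rewrite leq_eqVlt (negbTE ne) /= => lt_ix.
  apply: pidealMr; first exact: (hG_pint pp ds).
  apply: (hF_pideal pp dt) => //; rewrite /n; lia.
have Sp' : S' \in pideal p 1.
  apply: rpred_sum => -[i lti] _ /=.
  have ip : (i < p)%N by apply: leq_ltn_trans ltp.
  have nip : (n - i < p)%N by apply: leq_ltn_trans ltp; apply: leq_subr.
  have [lty|yi] := ltnP (r y2) i.
    by rewrite pidealMl ?Fp' //; apply: (hG_pideal pp dt).
  apply: pidealMr; first exact: (hG_pint pp dt).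
  apply: (hF_pideal pp ds) => //; lia.
have x2p : (r x2 < p)%N by apply: leq_ltn_trans ltp; apply: leq_addr.
have y1p : (r y1 < p)%N by apply: leq_ltn_trans ltp; apply: leq_addl.
have abI : a * b \in pideal p 1 by rewrite -(addrK S (a * b)) abE rpredB.
have /and3P[b0 _ bV] : b \in punit p by apply: (hF_unit pp dt).
have /negP[] : a \notin pideal p 1 by apply: (hG_unit pp ds).
by rewrite -(mulfK b0 a) pidealMl.
Qed.

(** * From large primes to all units *)

Definition inf_class (d c : nat) : Prop :=
  forall B, exists q, [/\ prime q, (B < q)%N & q = c %[mod d]].

(** There are finitely many classes modulo d, and those containing finitely
    many primes are exhausted beyond some bound. *)
Lemma large_primes_inf_class d : (0 < d)%N ->
  exists B, forall p, prime p -> (B < p)%N -> inf_class d p.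
Proof.
move=> d0.
have [B HB] : exists B, forall p, prime p -> (B < p)%N -> (p %% d < d)%N ->
    inf_class d p.
  elim: {2}d => [|k [B HB]]; first by exists 0%N.
  have [infk|] := pselect (inf_class d k).
    exists B => p pp Bp; rewrite ltnS leq_eqVlt => /orP[/eqP pk|]; last exact: HB.
    move=> C; have [q [qp Cq qk]] := infk C; exists q; split=> //.
    by rewrite qk -pk modn_mod.
  move/existsNP => [C HC]; exists (maxn B C) => p pp; rewrite gtn_max => /andP[Bp Cp].
  rewrite ltnS leq_eqVlt => /orP[/eqP pk|]; last exact: HB.
  by case: HC; exists p; split=> //; rewrite -pk modn_mod.
by exists B => p pp Bp; apply: HB => //; rewrite ltn_mod.
Qed.

(** A prime dividing the numerator of a nonzero x is at most that
    numerator. *)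
Lemma eq0_inf_pideal (x : rat) :
  (forall B, exists q, [/\ prime q, (B < q)%N & x \in pideal q 1]) -> x = 0.
Proof.
move=> xq; apply/eqP; rewrite -numq_eq0 -absz_eq0.
have [q [qp ltq xqI]] := xq `|numq x|%N; have q0 := prime_gt0 qp.
have : (`|numq x|%N)%:R \in pideal q 1.
  rewrite natr_absz intr_norm numqE normrM pidealMl //; last first.
    by rewrite -intr_norm int_pint // intr_int.
  by case: (ger0P x); rewrite ?rpredN.
rewrite pideal_nat // expn1; case: posnP => // n0 /(dvdn_leq n0).
by rewrite leqNgt ltq.
Qed.

(** Each coefficient of the difference is divisible by infinitely many primes
    of the class of p. *)
Lemma almost_integral_step d s p k :
  numerators d s -> almost_integral (log_mirror d s) ->
  prime p -> coprime p d -> inf_class d p -> k * p = 1 %[mod d] ->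
  log_mirror d (conjugate d k s) = log_mirror d s.
Proof.
move=> sd [B Bi] pp pd infp kp; apply/funext => n.
have kd : coprime k d.
  have : coprime (k * p) d by rewrite -coprime_modl kp coprime_modl coprime1n.
  by rewrite coprimeMl => /andP[].
apply/esym/eqP; rewrite -subr_eq0; apply/eqP; apply: eq0_inf_pideal => C.
have [q [qp]] := infp (maxn (maxn B C) (d * n)).
rewrite !gtn_max -andbA => /and3P[Bq Cq nq] qE; exists q; split=> //.
have qd : coprime q d by rewrite -coprime_modl qE coprime_modl.
have qk : q * k = 1 %[mod d] by rewrite -modnMml qE modnMml mulnC.
have cE : conjugate d q (conjugate d k s) = s by rewrite conjugate_conjugate conjugate1.
have := @log_mirror_congr q d (conjugate d k s) qp qd (conjugate_numerators kd sd) n.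
by rewrite cE; apply=> //; apply: Bi.
Qed.

(** By the Chinese remainder theorem n can be taken congruent to c modulo d
    and to 1 modulo every prime up to B that does not divide d. *)
Lemma rough_lift d c B : (0 < d)%N -> coprime c d ->
  exists n, [/\ (0 < n)%N, n = c %[mod d] &
    forall p, prime p -> (p %| n)%N -> (B < p)%N].
Proof.
move=> d0 cd; (* The bound 2 excludes n = 0, which every prime divides. *)
pose C := maxn B 2.
pose M := (\prod_(p < C.+1 | prime p && ~~ (p %| d)%N) p)%N.
have dM : coprime d M.
  rewrite /M; elim/big_rec: _ => [|p m /andP[pp pd] dm]; first exact: coprimen1.
  by rewrite coprimeMr dm andbT coprime_sym prime_coprime.
pose n := chinese d M c 1.
have nd : n = c %[mod d] by apply: chinese_modl.
have nM : n = 1 %[mod M] by apply: chinese_modr.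
have n_rough p : prime p -> (p %| n)%N -> (C < p)%N.
  move=> pp pn; rewrite ltnNge; apply/negP => pC.
  have p_not1 : ~~ (p %| 1)%N by rewrite Euclid_dvd1.
  have [p_d|pNd] := boolP (p %| d)%N.
    case/negP: p_not1; rewrite -(eqP cd) dvdn_gcd p_d andbT.
    by rewrite /dvdn -(modn_dvdm c p_d) -nd modn_dvdm.
  have pM : (p %| M)%N.
    have ltp : (p < C.+1)%N by rewrite ltnS.
    by rewrite /M (bigD1 (Ordinal ltp)) /= ?pp // dvdn_mulr.
  by case/negP: p_not1; rewrite /dvdn -(modn_dvdm 1 pM) -nM modn_dvdm.
exists n; split=> //.
  rewrite lt0n; apply/eqP => n0.
  by have := n_rough 2 isT; rewrite n0 dvdn0 => /(_ isT); rewrite ltnNge leq_maxr.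
by move=> p pp /(n_rough p pp); rewrite gtn_max => /andP[].
Qed.

(** A representative of the inverse of k with only large prime factors moves s
    to its conjugate one prime at a time, and each intermediate tuple has the
    same log_mirror, so it is again almost integral. *)
Lemma almost_integral_conjugate d s k : (0 < d)%N -> numerators d s ->
  almost_integral (log_mirror d s) -> coprime k d ->
  log_mirror d (conjugate d k s) = log_mirror d s.
Proof.
move=> d0 sd si kd; have [B HB] := large_primes_inf_class d0.
have [c ck] : exists c, c * k = 1 %[mod d].
  have [k0|k0] := posnP k.
    exists 0%N; move: kd; rewrite k0 /coprime gcd0n => /eqP ->.
    by rewrite !modn1.
  have [u v e _] := egcdnP d k0; exists u; rewrite e (eqP kd).
  by rewrite modnMDl.
have cd : coprime c d.
  have : coprime (c * k) d by rewrite -coprime_modl ck coprime_modl coprime1n.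
  by rewrite coprimeMl => /andP[].
have [n [n0 nc n_rough]] := rough_lift (maxn B d) d0 cd.
have : k * n = 1 %[mod d] by rewrite -modnMmr nc modnMmr mulnC.
elim/ltn_ind: n k {kd ck cd nc} n0 n_rough => n IHn k n0 n_rough kn.
have [n1|n_gt1] := leqP n 1.
  have n1' : n = 1%N by lia.
  by rewrite conjugate1 // -kn n1' muln1.
pose p := pdiv n; have pp : prime p := pdiv_prime n_gt1.
have p_n : (p %| n)%N := pdiv_dvd n.
pose m := (n %/ p)%N; have nE : n = (m * p)%N by rewrite divnK.
have := n_rough p pp p_n; rewrite gtn_max => /andP[Bp dp].
have pd : coprime p d by rewrite prime_coprime // gtnNdvd.
have m0 : (0 < m)%N by rewrite divn_gt0 ?prime_gt0 // dvdn_leq.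
have kp_m : (k * p) * m = 1 %[mod d] by rewrite -kn nE -mulnA (mulnC p).
have h1 : log_mirror d (conjugate d (k * p) s) = log_mirror d s.
  apply: (IHn m) => //; first by rewrite ltn_Pdiv // prime_gt1.
  by move=> q qp qm; apply: n_rough => //; rewrite nE dvdn_mulr.
have kpd : coprime (k * p) d.
  have : coprime (k * p * m) d by rewrite -coprime_modl kp_m coprime_modl coprime1n.
  by rewrite coprimeMl => /andP[].
rewrite -[RHS]h1; rewrite -h1 in si.
rewrite -(@almost_integral_step d (conjugate d (k * p) s) p (k * m) _ si pp pd (HB p pp Bp)).
- rewrite conjugate_conjugate; congr (log_mirror d _).
  rewrite -conjugate_mod -[RHS]conjugate_mod.
  congr (conjugate d _ s); have -> : (k * m * (k * p) = k * (k * n))%N by rewrite nE; ring.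
  by rewrite -modnMmr kn modnMmr muln1.
- exact: conjugate_numerators.
- by rewrite -kn nE mulnA.
Qed.

(** * The parameters are invariant under all units *)

Lemma log_mirror1 d s : log_mirror d s 1%N = hcoef s (frac d) 1 * hharm s (frac d) 1.
Proof.
have /(congr1 (fun f : fps => f 1%N)) := hT_mul s (frac d); rewrite /= fpsM.
by rewrite !big_ord_recl big_ord0 /= hT0 mul0r add0r addr0 hF0 mulr1.
Qed.

Lemma pbin1 x : pbin x 1 = x.
Proof. by rewrite /pbin /pochhammer big_ord1 addr0 divr1. Qed.

Lemma harm1 x : harm x 1 = x^-1 - 1.
Proof. by rewrite /harm big_ord1 !addr0 invr1. Qed.

(** The combination e3 - 4 e4 of the elementary symmetric functions. *)
Definition quartic (R : pzRingType) (a b c e : R) : R :=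
  a * b * c + a * b * e + a * c * e + b * c * e - 4%:R * (a * b * c * e).

Lemma log_mirror1_quartic d x1 x2 x3 x4 (a := frac d x1) (b := frac d x2)
    (c := frac d x3) (e := frac d x4) : numerators d [:: x1; x2; x3; x4] ->
  log_mirror d [:: x1; x2; x3; x4] 1%N = quartic a b c e.
Proof.
move=> vx; rewrite log_mirror1 /hcoef /hharm !big_cons !big_nil !pbin1 !harm1.
have nz x : x \in [:: x1; x2; x3; x4] -> frac d x != 0.
  move=> /vx /andP[x0 xd]; have d0 := ltn_trans x0 xd.
  by rewrite /frac mulf_neq0 ?invr_eq0 ?pnatr_eq0 -?lt0n.
have a0 : a != 0 by apply: nz; rewrite !inE eqxx.
have b0 : b != 0 by apply: nz; rewrite !inE eqxx !orbT.
have c0 : c != 0 by apply: nz; rewrite !inE eqxx !orbT.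
have e0 : e != 0 by apply: nz; rewrite !inE eqxx !orbT.
by rewrite -/a -/b -/c -/e /quartic; field; rewrite a0 b0 c0 e0.
Qed.

(** Write s = a + e = b + c, x = s/2 - a and y = s/2 - b; then the difference
    of the two values is (s - 1) (s (2 - s) + 2 x^2 + 2 y^2), whose second
    factor is positive. *)
Lemma quartic_opp (R : realFieldType) (a b c e : R) :
  a + e = b + c -> 0 < a < 1 -> 0 < e < 1 ->
  quartic a b c e = quartic (1 - e) (1 - c) (1 - b) (1 - a) -> a + e = 1.
Proof.
move=> ae /andP[a0 a1] /andP[e0 e1] E.
have cE : c = a + e - b by rewrite ae; ring.
have A0 : 0 < (a + e) * (2%:R - (a + e)) by apply: mulr_gt0; lra.
have X0 := sqr_ge0 ((a + e) / 2%:R - a).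
have Y0 := sqr_ge0 ((a + e) / 2%:R - b).
have : (a + e - 1) * ((a + e) * (2%:R - (a + e)) +
    2%:R * ((a + e) / 2%:R - a) ^+ 2 + 2%:R * ((a + e) / 2%:R - b) ^+ 2) = 0.
  move: E; rewrite cE /quartic => /eqP; rewrite -subr_eq0 => /eqP E.
  by rewrite -[RHS]E; field.
move/eqP; rewrite mulf_eq0 => /orP[|/eqP K0]; first by rewrite subr_eq0 => /eqP.
lra.
Qed.

(** With u = 1/2 - a and v = 1/2 - b the value is 1/4 - 4 (u v)^2, so u v and
    u - v are known, and u >= v >= 0. *)
Lemma quartic_sym_inj (R : realFieldType) (a b a' b' : R) :
  a <= b -> b <= 1 / 2%:R -> a' <= b' -> b' <= 1 / 2%:R -> b + a' = b' + a ->
  quartic a b (1 - b) (1 - a) = quartic a' b' (1 - b') (1 - a') -> a = a'.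
Proof.
move=> ab hb ab' hb' gap E.
pose u := 1 / 2%:R - a; pose v := 1 / 2%:R - b.
pose u' := 1 / 2%:R - a'; pose v' := 1 / 2%:R - b'.
have v0 : 0 <= v by rewrite /v; lra.
have v'0 : 0 <= v' by rewrite /v'; lra.
have u0 : 0 <= u by rewrite /u; lra.
have u'0 : 0 <= u' by rewrite /u'; lra.
have uvE : (u * v) ^+ 2 = (u' * v') ^+ 2.
  have e1 : quartic a b (1 - b) (1 - a) = 1 / 4%:R - 4%:R * (u * v) ^+ 2.
    by rewrite /quartic /u /v; field.
  have e2 : quartic a' b' (1 - b') (1 - a') = 1 / 4%:R - 4%:R * (u' * v') ^+ 2.
    by rewrite /quartic /u' /v'; field.
  by move: E; rewrite e1 e2; lra.
have uv : u * v = u' * v'.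
  by apply/eqP; rewrite -(@eqrXn2 _ 2) ?mulr_ge0 // uvE.
have du : u - v = u' - v' by rewrite /u /v /u' /v'; lra.
suff : u = u' by rewrite /u /u'; lra.
have : (u - u') * (u' + v) = 0.
  have -> : (u - u') * (u' + v) = u * v - u' * v' + u' * ((u - v) - (u' - v')) by ring.
  by rewrite uv du !subrr mulr0 addr0.
move/eqP; rewrite mulf_eq0 => /orP[|/eqP]; first by rewrite subr_eq0 => /eqP.
lra.
Qed.

Definition sorted4 (x1 x2 x3 x4 : nat) : Prop := [/\ x1 <= x2, x2 <= x3 & x3 <= x4]%N.

Section Orbit.
Variables (d : nat) (s : seq nat).
Hypotheses (d0 : (0 < d)%N) (sd : numerators d s).
Hypothesis (si : almost_integral (log_mirror d s)).

Definition in_orbit (t : seq nat) : Prop :=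
  exists2 k, coprime k d & perm_eq t (conjugate d k s).

Lemma in_orbit_numerators t : in_orbit t -> numerators d t.
Proof.
by case=> k kd tk x; rewrite (perm_mem tk); apply: conjugate_numerators.
Qed.

Lemma in_orbit_log_mirror t : in_orbit t -> log_mirror d t = log_mirror d s.
Proof. by case=> k kd tk; rewrite (log_mirror_perm _ tk) almost_integral_conjugate. Qed.

Lemma in_orbit_conjugate t c : coprime c d -> in_orbit t -> in_orbit (conjugate d c t).
Proof.
move=> cd [k kd tk]; exists (c * k)%N; first by rewrite coprimeMl cd.
by rewrite -conjugate_conjugate; apply: perm_map.
Qed.

Lemma in_orbit_perm t u : perm_eq u t -> in_orbit t -> in_orbit u.
Proof. by move=> ut [k kd tk]; exists k => //; apply: perm_trans tk. Qed.

(** All conjugates have the same log_mirror, in particular those multiplied by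
    any large prime. *)
Lemma orbit_gap x1 x2 x3 x4 y1 y2 y3 y4 :
  in_orbit [:: x1; x2; x3; x4] -> sorted4 x1 x2 x3 x4 ->
  in_orbit [:: y1; y2; y3; y4] -> sorted4 y1 y2 y3 y4 ->
  (x2 + y1 <= d)%N -> (x2 + y1 <= y2 + x1)%N.
Proof.
move=> ox [x12 x23 x34] oy [y12 y23 y34].
have [p dp pp] := prime_above (2 * d).
have pd : coprime p d by rewrite prime_coprime // gtnNdvd //; lia.
apply: (degree_gap pp dp (in_orbit_numerators ox) (in_orbit_numerators oy)) => //.
- by move=> x; rewrite !inE => /orP[]/eqP->; lia.
- by move=> x; rewrite !inE => /orP[]/eqP->; lia.
- by rewrite (in_orbit_log_mirror (in_orbit_conjugate pd ox))
     (in_orbit_log_mirror (in_orbit_conjugate pd oy)).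
Qed.

(** The unit -1 acts by x |-> d - x. *)
Lemma orbit_opp x1 x2 x3 x4 : in_orbit [:: x1; x2; x3; x4] ->
  in_orbit [:: d - x4; d - x3; d - x2; d - x1]%N.
Proof.
move=> ox; have vx := in_orbit_numerators ox.
have dd : coprime d.-1 d by case: (d) d0 => // n _; rewrite coprimenS.
have oppE x : (0 < x < d)%N -> (d.-1 * x %% d)%N = (d - x)%N.
  move=> /andP[x0 xd]; have -> : (d.-1 * x = x.-1 * d + (d - x))%N by nia.
  by rewrite modnMDl modn_small //; lia.
have := in_orbit_conjugate dd ox; rewrite /conjugate /= !oppE ?vx ?inE ?eqxx ?orbT //.
by apply: in_orbit_perm; rewrite -[X in perm_eq _ X]revK perm_sym perm_rev.
Qed.

(** Compare the gaps of the tuple and of its opposite in both directions;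
    the bound on the sum of the two numerators holds because the tuple is
    sorted. *)
Lemma orbit_middle x1 x2 x3 x4 :
  in_orbit [:: x1; x2; x3; x4] -> sorted4 x1 x2 x3 x4 -> (x1 + x4 = x2 + x3)%N.
Proof.
move=> ox sx; have oo := orbit_opp ox; have vx := in_orbit_numerators ox.
have /andP[_ h1] : (0 < x1 < d)%N by apply: vx; rewrite !inE eqxx.
have /andP[_ h2] : (0 < x2 < d)%N by apply: vx; rewrite !inE eqxx orbT.
have /andP[_ h3] : (0 < x3 < d)%N by apply: vx; rewrite !inE eqxx !orbT.
have /andP[_ h4] : (0 < x4 < d)%N by apply: vx; rewrite !inE eqxx !orbT.
have so : sorted4 (d - x4) (d - x3) (d - x2) (d - x1).
  by case: sx => *; split; lia.
case: (sx) => *; have := orbit_gap ox sx oo so; have := orbit_gap oo so ox sx.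
lia.
Qed.

Lemma frac_opp x : (x <= d)%N -> frac d (d - x) = 1 - frac d x.
Proof.
move=> xd; rewrite /frac natrB // mulrBl divff // pnatr_eq0 -lt0n //.
Qed.

Lemma frac_bound x : (0 < x < d)%N -> 0 < frac d x < 1.
Proof.
move=> /andP[x0 xd]; rewrite /frac divr_gt0 ?ltr0n //=.
by rewrite ltr_pdivrMr ?ltr0n // mul1r ltr_nat.
Qed.

Lemma frac_inj : injective (frac d).
Proof.
move=> x y /(mulIf _) e; apply/eqP; rewrite -(eqr_nat rat); apply/eqP/e.
by rewrite invr_eq0 pnatr_eq0 -lt0n.
Qed.

(** The sums x1 + x4 and x2 + x3 agree, and the coefficient of z is the same
    for the opposite tuple. *)
Lemma orbit_symmetric x1 x2 x3 x4 :
  in_orbit [:: x1; x2; x3; x4] -> sorted4 x1 x2 x3 x4 ->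
  x4 = (d - x1)%N /\ x3 = (d - x2)%N.
Proof.
move=> ox sx; have oo := orbit_opp ox; have vx := in_orbit_numerators ox.
have h1 : (0 < x1 < d)%N by apply: vx; rewrite !inE eqxx.
have h2 : (0 < x2 < d)%N by apply: vx; rewrite !inE eqxx orbT.
have h3 : (0 < x3 < d)%N by apply: vx; rewrite !inE eqxx !orbT.
have h4 : (0 < x4 < d)%N by apply: vx; rewrite !inE eqxx !orbT.
have mid := orbit_middle ox sx.
have le z : (0 < z < d)%N -> (z <= d)%N by case/andP => _ /ltnW.
have E := log_mirror1_quartic (in_orbit_numerators oo).
rewrite (in_orbit_log_mirror oo) -(in_orbit_log_mirror ox) (log_mirror1_quartic vx) in E.
rewrite (frac_opp (le _ h1)) (frac_opp (le _ h2)) in E.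
rewrite (frac_opp (le _ h3)) (frac_opp (le _ h4)) in E.
have fmid : frac d x1 + frac d x4 = frac d x2 + frac d x3.
  by rewrite /frac -!mulrDl -!natrD mid.
have e := quartic_opp fmid (frac_bound h1) (frac_bound h4) E.
have x4E : x4 = (d - x1)%N.
  apply: frac_inj; rewrite (frac_opp (le _ h1)).
  by apply: (canRL (addrK _)); rewrite addrC.
by split=> //; move: mid x4E h1 h2 h3 h4; clear; lia.
Qed.

(** By symmetry x2 and y1 are at most d/2, so the gaps agree; the coefficient
    of z then determines the tuple. *)
Lemma orbit_constant x1 x2 x3 x4 y1 y2 y3 y4 :
  in_orbit [:: x1; x2; x3; x4] -> sorted4 x1 x2 x3 x4 ->
  in_orbit [:: y1; y2; y3; y4] -> sorted4 y1 y2 y3 y4 ->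
  [:: x1; x2; x3; x4] = [:: y1; y2; y3; y4].
Proof.
move=> ox sx oy sy.
have [x4E x3E] := orbit_symmetric ox sx; have [y4E y3E] := orbit_symmetric oy sy.
have vx := in_orbit_numerators ox; have vy := in_orbit_numerators oy.
have h1 : (0 < x1 < d)%N by apply: vx; rewrite !inE eqxx.
have h2 : (0 < x2 < d)%N by apply: vx; rewrite !inE eqxx orbT.
have k1 : (0 < y1 < d)%N by apply: vy; rewrite !inE eqxx.
have k2 : (0 < y2 < d)%N by apply: vy; rewrite !inE eqxx orbT.
have xgap := orbit_gap ox sx oy sy; have ygap := orbit_gap oy sy ox sx.
have gap : (x2 + y1 = y2 + x1)%N by case: sx sy => ? ? ? [? ? ?]; lia.
have le z : (0 < z < d)%N -> (z <= d)%N by case/andP => _ /ltnW.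
have E := log_mirror1_quartic vx.
rewrite (in_orbit_log_mirror ox) -(in_orbit_log_mirror oy) in E.
rewrite (log_mirror1_quartic vy) x4E x3E y4E y3E in E.
rewrite (frac_opp (le _ h1)) (frac_opp (le _ h2)) in E.
rewrite (frac_opp (le _ k1)) (frac_opp (le _ k2)) in E.
have fgap : frac d x2 + frac d y1 = frac d y2 + frac d x1.
  by rewrite /frac -!mulrDl -!natrD gap.
have half z : (z <= d - z)%N -> frac d z <= 1 / 2%:R.
  move=> zd; rewrite /frac ler_pdivrMr ?ltr0n // mulrAC ler_pdivlMr ?ltr0n //.
  by rewrite mul1r -natrM ler_nat; move: zd; clear; lia.
have fle u v : (u <= v)%N -> frac d u <= frac d v.
  by move=> uv; rewrite /frac ler_pM2r ?invr_gt0 ?ltr0n // ler_nat.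
have [[x12 x23 _] [y12 y23 _]] := (sx, sy).
have xy1 : x1 = y1.
  apply: frac_inj; apply/esym.
  apply: quartic_sym_inj (fle _ _ y12) _ (fle _ _ x12) _ _ E => //.
  - by apply: half; rewrite -y3E.
  - by apply: half; rewrite -x3E.
have xy2 : x2 = y2 by move: gap xy1; clear; lia.
by rewrite x4E x3E y4E y3E xy1 xy2.
Qed.

End Orbit.

(** * Classification *)

Lemma sort4 (s : seq nat) : size s = 4 ->
  exists x1 x2 x3 x4, perm_eq [:: x1; x2; x3; x4] s /\ sorted4 x1 x2 x3 x4.
Proof.
move=> s4; have := permEl (perm_sort leq s); have := sort_sorted leq_total s.
have : size (sort leq s) = 4 by rewrite size_sort.
case: (sort leq s) => [|x1 [|x2 [|x3 [|x4 []]]]] //= _ /and3P[h1 h2 /andP[h3 _]] st.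
by exists x1, x2, x3, x4.
Qed.

Lemma almost_integral_closed d s : (0 < d)%N -> numerators d s -> size s = 4 ->
  almost_integral (log_mirror d s) ->
  (exists x1 x2, [/\ (0 < x1)%N, (x1 <= x2)%N, (x2 <= d - x2)%N &
      perm_eq s [:: x1; x2; d - x2; d - x1]%N]) /\
  forall k, coprime k d -> perm_eq (conjugate d k s) s.
Proof.
move=> d0 sd s4 si.
have [x1 [x2 [x3 [x4 [xs sx]]]]] := sort4 s4.
have ox : in_orbit d s [:: x1; x2; x3; x4].
  by exists 1%N; [exact: coprime1n | rewrite conjugate1].
have [x4E x3E] := orbit_symmetric d0 sd si ox sx; split.
  exists x1, x2; case: (sx) => h1 h2 h3; split=> //; last 1 first.
  - by rewrite perm_sym -x4E -x3E.
  - by have /andP[] := in_orbit_numerators sd ox (mem_head _ _).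
  - by rewrite -x3E.
move=> k kd; have [y1 [y2 [y3 [y4 [ys sy]]]]] : exists y1 y2 y3 y4,
   perm_eq [:: y1; y2; y3; y4] (conjugate d k s) /\ sorted4 y1 y2 y3 y4.
  by apply: sort4; rewrite size_map.
have oy : in_orbit d s [:: y1; y2; y3; y4] by exists k.
rewrite perm_sym in ys; apply: perm_trans ys _.
by rewrite -(orbit_constant d0 sd si ox sx oy sy).
Qed.

(** A prime power p^e exactly dividing n satisfies (p - 1) p^(e-1) <= 4, so it
    is one of 2, 4, 8, 3, 5. *)
Lemma totient_le4 n : (0 < n)%N -> (totient n <= 4)%N -> (n %| 120)%N.
Proof.
move=> n0 tn.
have part p : prime p -> (p %| n)%N -> (p.-1 * p ^ (logn p n).-1 <= 4)%N.
  move=> pp pn; have e0 : (0 < logn p n)%N by rewrite logn_gt0 mem_primes pp n0.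
  have [m pm nE] := pfactor_coprime pp n0.
  rewrite -totient_pfactor //; apply: leq_trans tn.
  rewrite [in X in (_ <= X)%N]nE totient_coprime; last by rewrite coprime_sym coprimeXl.
  rewrite leq_pmull // totient_gt0; move: n0; rewrite nE; by case: (m).
apply/dvdn_partP => // p; rewrite mem_primes => /and3P[pp _ pn].
have := part p pp pn; rewrite p_part.
have : (0 < logn p n)%N by rewrite logn_gt0 mem_primes pp n0.
case: (logn p n) => // e _ /= le4.
have p2 := prime_gt1 pp.
have pe : (0 < p ^ e)%N by rewrite expn_gt0 prime_gt0.
have ple : (p <= 5)%N by move: le4 p2 pe; clear; nia.
have e3 : (e < 3)%N.
  rewrite ltnNge; apply/negP => e3; have : (2 ^ 3 <= p ^ e)%N.
    by apply: leq_trans (leq_pexp2l _ e3); rewrite ?leq_exp2r ?prime_gt0.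
  by move: le4 p2; clear; nia.
case: e e3 le4 {pe} => [|[|[|e]]] //; case: p pp {part pn p2} ple => [|[|[|[|[|[|p]]]]]] //.
Qed.

(** A representative of c whose prime factors all exceed d is prime to d. *)
Lemma unit_lift n d c : (0 < n)%N -> (0 < d)%N -> coprime c n ->
  exists2 k, coprime k d & k = c %[mod n].
Proof.
move=> n0 d0 cn; have [k [k0 kc k_rough]] := rough_lift d n0 cn; exists k => //.
rewrite /coprime; apply: contraT => g1.
have gk : (1 < gcdn k d)%N by rewrite ltn_neqAle eq_sym g1 gcdn_gt0 k0.
have pg := pdiv_dvd (gcdn k d); rewrite dvdn_gcd in pg.
case/andP: pg => pk /(dvdn_leq d0); rewrite leqNgt.
by rewrite k_rough // pdiv_prime.
Qed.

(** If x/d = m/n in lowest terms, all reduced fractions j/n are obtained from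
    it by units, so they occur among the four parameters and phi(n) <= 4. *)
Lemma closed_denominator d s x : (0 < d)%N -> numerators d s -> size s = 4 ->
  (forall k, coprime k d -> perm_eq (conjugate d k s) s) -> x \in s ->
  (d %/ gcdn x d %| 120)%N.
Proof.
move=> d0 sd s4 closed xs; have /andP[x0 xd] := sd x xs.
set g := gcdn x d; have g0 : (0 < g)%N by rewrite gcdn_gt0 x0.
have gd : (g %| d)%N := dvdn_gcdr x d; have gx : (g %| x)%N := dvdn_gcdl x d.
set n := (d %/ g)%N; have dE : d = (n * g)%N by rewrite divnK.
set m := (x %/ g)%N; have xE : x = (m * g)%N by rewrite divnK.
have n0 : (0 < n)%N by rewrite divn_gt0 // dvdn_leq.
have mn : coprime m n.
  by rewrite /coprime -(eqn_pmul2r g0) muln_gcdl -xE -dE mul1n.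
have m0 : (0 < m)%N by rewrite divn_gt0 // dvdn_leq.
have [u v e _] := egcdnP n m0; rewrite (eqP mn) in e.
have um : u * m = 1 %[mod n] by rewrite e modnMDl.
have un : coprime u n.
  have : coprime (u * m) n by rewrite -coprime_modl um coprime_modl coprime1n.
  by rewrite coprimeMl => /andP[].
apply: totient_le4 => //; rewrite totient_count_coprime.
pose js := [seq j <- iota 0 n | coprime n j].
have -> : (\sum_(0 <= j < n) coprime n j)%N = size js.
  rewrite size_filter -sum1_count [RHS]big_mkcond /index_iota subn0.
  by apply: eq_bigr => j _; case: coprime.
rewrite -(size_map (muln^~ g)); apply: leq_trans (_ : size s <= 4)%N; last first.
  by rewrite s4.
apply: uniq_leq_size.
  rewrite map_inj_uniq ?filter_uniq ?iota_uniq // => i j /eqP.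
  by rewrite eqn_pmul2r // => /eqP.
move=> y /mapP[j]; rewrite mem_filter mem_iota add0n => /andP[nj /= jn] ->.
have cjn : coprime (j * u) n by rewrite coprimeMl coprime_sym nj.
have [k kd kE] := unit_lift n0 d0 cjn.
rewrite -(perm_mem (closed k kd)); apply/mapP; exists x => //.
rewrite {1}xE mulnA dE -muln_modl -modnMml kE modnMml -mulnA -modnMmr um modnMmr muln1.
by rewrite modn_small.
Qed.

(** The pairs of the classification, as numerators over 120. *)
Definition pairs120 : seq (nat * nat) :=
  [:: (60, 60); (40, 80); (30, 60); (30, 30); (48, 24); (45, 15); (36, 12);
      (60, 20); (60, 40); (40, 20); (20, 20); (40, 30); (30, 20); (50, 10)]%N.

Definition quad120 (u v : nat) : seq nat := [:: u; v; 120 - u; 120 - v]%N.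

Definition closed120 (s : seq nat) : bool :=
  all (fun k => coprime k 120 ==> perm_eq (conjugate 120 k s) s) (iota 0 120).

Lemma pairs120_closed : all (fun q => closed120 (quad120 q.1 q.2)) pairs120.
Proof. by vm_compute. Qed.

(** The units 7 and 11 modulo 120 are enough to exclude every other
    quadruple. *)
Definition closed_listed (s : seq nat) : bool :=
  if perm_eq (conjugate 120 7 s) s then if perm_eq (conjugate 120 11 s) s then
    has (fun q => perm_eq s (quad120 q.1 q.2)) pairs120 else true else true.

Lemma closed120_pairs :
  all (fun u => all (fun v => closed_listed (quad120 u v)) (iota 1 60)) (iota 1 60).
Proof. by vm_compute. Qed.

Lemma mirror_pairs120 :
  mirror_pairs = [seq (frac 120 q.1, frac 120 q.2) | q <- pairs120].
Proof. by apply/eqP; vm_compute. Qed.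

Lemma pairs120_bounds :
  all (fun q => [&& 0 < q.1, q.1 < 120, 0 < q.2 & q.2 < 120]%N) pairs120.
Proof. by []. Qed.

Lemma frac_quad120 u v : (u <= 120)%N -> (v <= 120)%N ->
  [seq frac 120 x | x <- quad120 u v] =
  [:: frac 120 u; frac 120 v; 1 - frac 120 u; 1 - frac 120 v].
Proof. by move=> u120 v120; rewrite /= !frac_opp. Qed.

(** A multiple of 120 is taken so that the units modulo 120 lift to units
    modulo d. *)
Lemma common_denominator (a : seq rat) : {in a, forall x, 0 < x < 1} ->
  exists d s, [/\ (0 < d)%N, (120 %| d)%N, numerators d s & a = map (frac d) s].
Proof.
move=> a01; pose d := (120 * \prod_(x <- a) `|denq x|)%N.
have dx x : x \in a -> exists2 m, x = frac d m & (0 < m < d)%N.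
  move=> xa; have /andP[x0 x1] := a01 x xa.
  have [c dE] : exists c, d = (c * `|denq x|)%N.
    by apply/dvdnP; rewrite /d dvdn_mull // (big_rem x) //= dvdn_mulr.
  have d0 : (0 < d)%N.
    rewrite /d muln_gt0 /=; elim/big_rec: _ => // y m _ m0.
    by rewrite muln_gt0 m0 absz_gt0 denq_neq0.
  have dn0 : d%:R != 0 :> rat by rewrite pnatr_eq0 -lt0n.
  have xE : x = frac d (c * `|numq x|).
    apply: (canRL (mulfK dn0)); rewrite dE !natrM mulrCA !natr_absz.
    rewrite !(gtr0_norm (denq_gt0 _)) gtr0_norm ?numq_gt0 //.
    by rewrite -numqE.
  set m := (c * `|numq x|)%N in xE; exists m => //; move: x0 x1; rewrite xE /frac.
  rewrite pmulr_lgt0 ?invr_gt0 ?ltr0n // => ->.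
  by rewrite ltr_pdivrMr ?ltr0n // mul1r ltr_nat.
exists d; have d0 : (0 < d)%N.
  rewrite /d muln_gt0 /=; elim/big_rec: _ => // y m _ m0.
  by rewrite muln_gt0 m0 absz_gt0 denq_neq0.
have d120 : (120 %| d)%N by rewrite /d dvdn_mulr.
move: (d) d0 d120 dx => D D0 D120 {d a01}.
elim: a => [|x a IHa] dx; first by exists [::].
have [|s [_ _ vs aE]] := IHa; first by move=> y ya; apply: dx; rewrite inE ya orbT.
have [m xE mD] := dx x (mem_head _ _).
exists (m :: s); split=> //; last by rewrite /= -xE -aE.
by move=> y; rewrite inE => /orP[/eqP->|/vs].
Qed.

Theorem mainTheorem3 (a : 4.-tuple rat)
    (ha : forall i : 'I_4, 0 < tnth a i < 1) :
  N_integral (mirror_map a) <->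
  exists2 p : rat * rat, p \in mirror_pairs &
    perm_eq a [:: p.1; p.2; 1 - p.1; 1 - p.2].
Proof.
split=> [a_int | [p]].
  have [d [s [d0 d120 sd aE]]] : exists d s,
    [/\ (0 < d)%N, (120 %| d)%N, numerators d s & a = map (frac d) s :> seq rat].
    by apply: common_denominator => x /tnthP[i ->]; apply: ha.
  have s4 : size s = 4 by rewrite -(size_map (frac d)) -aE size_tuple.
  have as_ : perm_eq a (map (frac d) s) by rewrite aE.
  have [[x1 [x2 [x10 x12 x2d sE]]] closed] :=
    almost_integral_closed d0 sd s4 (N_integral_almost as_ a_int).
  have [e dE] : exists e, d = (120 * e)%N.
    by have [e eE] := dvdnP d120; exists e; rewrite mulnC.
  have e0 : (0 < e)%N by move: d0; rewrite dE; case: (e).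
  have dvd_e x : x \in s -> (e %| x)%N.
    move=> xs; apply: dvdn_trans (dvdn_gcdl x d).
    have /dvdnP[h hE] := closed_denominator d0 sd s4 closed xs.
    set g := gcdn x d in hE *; have gd : (g %| d)%N := dvdn_gcdr x d.
    apply/dvdnP; exists h; apply/eqP; rewrite -(eqn_pmul2l (_ : 0 < d %/ g)%N).
      by rewrite (divnK gd) mulnA [(_ * h)%N]mulnC -hE -dE.
    have g0 : (0 < g)%N by rewrite gcdn_gt0 d0 orbT.
    by rewrite (divn_gt0 _ g0) (dvdn_leq d0 gd).
  have [u uE] : exists u, x1 = (u * e)%N.
    by apply/dvdnP/dvd_e; rewrite (perm_mem sE) inE eqxx.
  have [v vE] : exists v, x2 = (v * e)%N.
    by apply/dvdnP/dvd_e; rewrite (perm_mem sE) !inE eqxx orbT.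
  have u0 : (0 < u)%N by move: x10; rewrite uE; case: (u).
  have uv : (u <= v)%N by move: x12; rewrite uE vE leq_pmul2r.
  have v60 : (v <= 60)%N.
    by move: x2d; rewrite vE dE -mulnBl; move: e0; clear; nia.
  have sq : perm_eq s [seq (x * e)%N | x <- quad120 u v].
    rewrite (permPl sE) /= !mulnBl -uE -vE -dE !perm_cons.
    by rewrite -[X in perm_eq _ X]revK perm_sym perm_rev.
  have unit_closed c : coprime c 120 ->
      perm_eq (conjugate 120 c (quad120 u v)) (quad120 u v).
    move=> c120; have [k kd kE] := unit_lift (isT : (0 < 120)%N) d0 c120.
    have e_inj : injective (muln^~ e) by move=> x y /eqP; rewrite eqn_pmul2r // => /eqP.
    apply: (perm_map_inj e_inj); rewrite -(permPr sq).
    apply: perm_trans (closed k kd); rewrite perm_sym.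
    apply: perm_trans (perm_map (fun x => k * x %% d)%N sq) _.
    rewrite -!map_comp; apply/permP => P; congr (count P _); apply: eq_map => x /=.
    by rewrite mulnA dE -muln_modl -modnMml kE modnMml.
  have u60 : (u <= 60)%N := leq_trans uv v60.
  have uI : u \in iota 1 60 by rewrite mem_iota u0 add1n ltnS.
  have vI : v \in iota 1 60 by rewrite mem_iota (leq_trans u0 uv) add1n ltnS.
  have := allP (allP closed120_pairs u uI) v vI.
  rewrite /closed_listed !unit_closed // => /hasP[q qin uvq].
  have /and4P[_ q1 _ q2] := allP pairs120_bounds q qin.
  exists (frac 120 q.1, frac 120 q.2).
    by rewrite mirror_pairs120; apply/mapP; exists q.
  rewrite -frac_quad120 1?ltnW // aE.
  apply: perm_trans (perm_map (frac d) sq) _.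
  have -> : [seq frac d x | x <- [seq (x * e)%N | x <- quad120 u v]] =
            [seq frac 120 x | x <- quad120 u v].
    rewrite -map_comp; apply: eq_map => x /=; rewrite /frac dE !natrM.
    by rewrite -mulf_div divff ?mulr1 // pnatr_eq0 -lt0n.
  exact: perm_map.
rewrite mirror_pairs120 => /mapP[q qin ->] /=.
have /and4P[q10 q1 q20 q2] := allP pairs120_bounds q qin.
rewrite -frac_quad120 1?ltnW // => as_; apply: (almost_N_integral as_) => //.
  move=> x; rewrite !inE => /or4P[]/eqP->; rewrite ?q10 ?q20 //; lia.
exists 5%N => l pl l5; have l120 : coprime l 120.
  rewrite prime_coprime //; apply: contraL l5 => l_dvd.
  have : l \in primes 120 by rewrite mem_primes pl l_dvd.
  by rewrite (_ : primes 120 = [:: 2; 3; 5]) // !inE => /or3P[]/eqP->.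
apply: log_mirror_fint => //.
  by move=> x; rewrite !inE => /or4P[]/eqP->; rewrite ?q10 ?q20 //; lia.
have := allP (allP pairs120_closed q qin) (l %% 120)%N.
rewrite mem_iota ltn_mod coprime_modl l120 conjugate_mod; exact.
Qed.
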